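(* Let $m\ge 1$ and let $A_i,B_i$ be $n\times n$ complex positive definite matrices for all $i=1,\dots,m$. Then for all $p>0$ and all $r\ge 1$, $$\left\|\sum_{i=1}^m\left(A_i^2\sharp B_i^2\right)^r\right\|_1\le\left\|\left(\left(\sum_{i=1}^mA_i\right)^{\frac{pr}{2}}\left(\sum_{i=1}^mB_i\right)^{pr}\left(\sum_{i=1}^mA_i\right)^{\frac{rp}{2}}\right)^{\frac1p}\right\|_1 .$$
   Context: For positive definite $n\times n$ complex matrices $X,Y$, the geometric mean is $X\sharp Y=X^{1/2}\left(X^{-1/2}YX^{-1/2}\right)^{1/2}X^{1/2}$. $\|X\|_1=\operatorname{tr}|X|$, with $|X|=(X^*X)^{1/2}$, is the trace norm. Real powers of positive definite matrices are defined by the functional calculus. *)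

(* Defs.v *)
From mathcomp Require Export all_boot all_order all_algebra.
From mathcomp Require Export complex.
From mathcomp Require Export reals exp.

Set Implicit Arguments.
Unset Strict Implicit.
Unset Printing Implicit Defensive.

Import Order.TTheory GRing.Theory Num.Theory.
Local Open Scope ring_scope.
Local Open Scope sesquilinear_scope.

Definition posdefmx (R : realType) (n : nat) (A : 'M[R[i]]_n) : Prop :=
  A \is hermsymmx /\
  forall x : 'cV[R[i]]_n, x != 0 -> 0 < (x ^t* *m A *m x) 0 0.

(* f (A) = U^-1 diag (f a_1, ..., f a_n) U for the library's unitary
   diagonalisation A = U^-1 diag (a_1, ..., a_n) U, which exists for A normal;
   meant for Hermitian A only, whose eigenvalues a_j are real. *)
Definition mxfun (R : realType) (f : R -> R) (n : nat) (A : 'M[R[i]]_n) :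
    'M[R[i]]_n :=
  invmx (spectralmx A)
  *m diag_mx (map_mx (fun z => real_complex R (f (complex.Re z)))
                     (spectral_diag A))
  *m spectralmx A.

Definition mxpowR (R : realType) (n : nat) (A : 'M[R[i]]_n) (t : R) :
    'M[R[i]]_n :=
  mxfun (fun a => powR a t) A.

Definition geomean (R : realType) (n : nat) (X Y : 'M[R[i]]_n) : 'M[R[i]]_n :=
  mxpowR X (1 / 2)
  *m mxpowR (mxpowR X (- (1 / 2)) *m Y *m mxpowR X (- (1 / 2))) (1 / 2)
  *m mxpowR X (1 / 2).

Definition absmx (R : realType) (n : nat) (X : 'M[R[i]]_n) : 'M[R[i]]_n :=
  mxpowR (X ^t* *m X) (1 / 2).

(* Complex-valued, like the norm on R[i] itself; an inequality u <= v in R[i]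
   means that u and v have equal imaginary parts and that Re u <= Re v. *)
Definition tracenorm (R : realType) (n : nat) (X : 'M[R[i]]_n) : R[i] :=
  \tr (absmx X).

(* Main.v *)
From HB Require Import structures.
Require Import Defs.
From mathcomp Require Import perm ring lra zify.
Set Implicit Arguments.
Unset Strict Implicit.
Unset Printing Implicit Defensive.
Import Order.TTheory GRing.Theory Num.Theory.
Local Open Scope ring_scope.
Local Open Scope sesquilinear_scope.

(** Write A and B for the sums of the A_i and of the B_i, X # Y for the
    geometric mean, and phi(q) = tr (A^(q/2) B^q A^(q/2))^(r/q).  All matrices
    under a trace norm are positive definite, so the norms are traces and the
    right-hand side is phi(pr).  The inequality is the end of the chain

      sum_i tr (A_i^2 # B_i^2)^r <= sum_i tr (A_i # B_i)^(2r)
                                 <= tr (A # B)^(2r) <= phi(q)  for all q > 0.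

    The first and third steps come from one majorization principle.  Let N be
    positive definite and similar to a product XY.  If S has as columns the
    eigenvectors of XY for its k largest eigenvalues l_1, ..., l_k, then
    det (S^H XY S) = det (S^H S) l_1 ... l_k.  The Cauchy-Schwarz inequality
    for determinants bounds the square of this by
    det (S^H X X^H S) det (S^H Y^H Y S), and compressing a positive definite H
    to the columns of S costs at most the product of its k largest
    eigenvalues: det (S^H H S) <= det (S^H S) h_1 ... h_k.  Both determinant
    facts follow from the Cauchy-Binet formula.  So the l_j^2 are weakly
    log-majorized by the products of the eigenvalues of X X^H and Y^H Y
    ([eigen_prod_le]), and the tangent inequality for the exponential together
    with summation by parts converts this into sums of arbitrary positive
    powers.  The consequences in use are a Hoelder inequality
    ([trpow_holder]) and its limit case where X is a contraction
    ([trpow_contraction]).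

    First step.  G = A # B and X = A^2 # B^2 are characterized by the Riccati
    equations G A^-1 G = B and X A^-2 X = B^2.  Put g = G^(1/2) and
    N = g^-1 X g^-1.  The two equations say that N is similar to g U g with U
    unitary, whence tr N^(2r) <= tr G^(2r); and X is similar to G N, whence
    tr X^r <= (tr G^(2r) + tr N^(2r)) / 2 ([trpow_geom_square]).

    Second step.  The geometric mean is superadditive ([geom_sum_le]), and
    sum_i tr G_i^u <= tr T^u whenever sum_i G_i <= T and u >= 2
    ([sum_trpow_le]); here u = 2r, and this is where r >= 1 enters.

    Third step.  The first step, applied to repeated square roots of A and B,
    gives tr (A # B)^(2r) <= tr (A^d # B^d)^(2r/d) for d = 2^-k, and the
    latter is at most phi(d) because P # Q is similar to a matrix Y with
    Y^H Y = P^(1/2) Q P^(1/2).  It remains to see that phi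
    increases, the Araki-Lieb-Thirring inequality: the Hoelder inequality
    bounds phi at the midpoint of two exponents by a mean of its values there,
    so phi(tq) <= phi(q) for dyadic t in (0, 1], and a semicontinuity of phi
    from below removes the restriction on t ([araki_mono]). *)

(** * Functional calculus on positive definite matrices *)

Notation "x %:C" := (real_complex _ x) : ring_scope.

(** Sealed, like the definitions below, so that unification never compares
    matrices entry by entry. *)
HB.lock Definition adjmx (C : numClosedFieldType) m n (A : 'M[C]_(m, n)) :
  'M[C]_(n, m) := A ^t*.
Notation "A ^H" := (adjmx A) (at level 8, format "A ^H") : ring_scope.

HB.lock Definition rdiag (R : realType) n (d : 'I_n -> R) : 'M[R[i]]_n :=
  diag_mx (\row_j (d j)%:C).

(** The Hermitian matrix with eigenvalues [d] and eigenvectors the columns of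
    [U^H], for [U] unitary. *)
HB.lock Definition spec (R : realType) n (U : 'M[R[i]]_n) (d : 'I_n -> R) :
  'M[R[i]]_n := U^H *m rdiag d *m U.

HB.lock Definition rpow (R : realType) n (A : 'M[R[i]]_n) (t : R) :
  'M[R[i]]_n := mxpowR A t.

Section Adjoint.
Variable C : numClosedFieldType.

Lemma adjmxM m n p (A : 'M[C]_(m, n)) (B : 'M[C]_(n, p)) :
  (A *m B)^H = B^H *m A^H.
Proof. by rewrite adjmx.unlock trmx_mul map_mxM. Qed.

Lemma adjmx1 n : (1%:M : 'M[C]_n)^H = 1%:M.
Proof. by rewrite adjmx.unlock trmx1 map_mx1. Qed.

Lemma adjmxK m n (A : 'M[C]_(m, n)) : A^H^H = A.
Proof. by rewrite adjmx.unlock trmxCK. Qed.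

Lemma adjmxD m n (A B : 'M[C]_(m, n)) : (A + B)^H = A^H + B^H.
Proof. by rewrite adjmx.unlock linearD /= map_mxD. Qed.

Lemma adjmxB m n (A B : 'M[C]_(m, n)) : (A - B)^H = A^H - B^H.
Proof. by rewrite adjmx.unlock linearB /= map_mxB. Qed.

Lemma adjmxE m n (A : 'M[C]_(m, n)) i j : A^H i j = (A j i)^*.
Proof. by rewrite adjmx.unlock !mxE. Qed.

Lemma adjmx_inv n (A : 'M[C]_n) : A \in unitmx -> (invmx A)^H = invmx A^H.
Proof.
move=> uA; have h : A^H *m (invmx A)^H = 1%:M.
  by rewrite -adjmxM mulVmx // adjmx1.
by have [uH _] := mulmx1_unit h; rewrite -[LHS](mulKmx uH) h mulmx1.
Qed.

Lemma unitmx_adj n (A : 'M[C]_n) : (A^H \in unitmx) = (A \in unitmx).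
Proof.
suff h B : B \in unitmx -> B^H \in @unitmx C n.
  by apply/idP/idP => [/h|/h//]; rewrite adjmxK.
move=> uB; have : B^H *m (invmx B)^H = 1%:M by rewrite -adjmxM mulVmx // adjmx1.
by case/mulmx1_unit.
Qed.

Lemma unitaryK n (U : 'M[C]_n) : U \is unitarymx -> U *m U^H = 1%:M.
Proof. by rewrite adjmx.unlock => /unitarymxP. Qed.

Lemma unitaryKV n (U : 'M[C]_n) : U \is unitarymx -> U^H *m U = 1%:M.
Proof. by move=> /unitaryK/mulmx1C. Qed.

Lemma unitaryE n (U : 'M[C]_n) : U *m U^H = 1%:M -> U \is unitarymx.
Proof. by rewrite adjmx.unlock => h; apply/unitarymxP. Qed.

End Adjoint.

HB.lock Definition posdef (R : realType) n (A : 'M[R[i]]_n) : Prop :=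
  A^H = A /\ forall x : 'cV[R[i]]_n, x != 0 -> 0 < (x^H *m A *m x) 0 0.

HB.lock Definition psd (R : realType) n (A : 'M[R[i]]_n) : Prop :=
  forall x : 'cV[R[i]]_n, 0 <= (x^H *m A *m x) 0 0.

Section Calculus.
Variable R : realType.
Notation C := R[i].

Lemma conj_realC (x : R) : (x%:C)^* = x%:C.
Proof. by apply/CrealP; rewrite complex_real. Qed.

Lemma adj_rdiag n (d : 'I_n -> R) : (rdiag d)^H = rdiag d.
Proof.
rewrite rdiag.unlock adjmx.unlock tr_diag_mx; apply/matrixP => i j.
by rewrite !mxE rmorphMn /= conj_realC.
Qed.

Lemma rdiagM n (d e : 'I_n -> R) :
  rdiag d *m rdiag e = rdiag (fun j => d j * e j).
Proof.
rewrite rdiag.unlock mulmx_diag; congr diag_mx; apply/rowP => j.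
by rewrite !mxE rmorphM.
Qed.

Lemma adj_spec n (U : 'M[C]_n) d : (spec U d)^H = spec U d.
Proof. by rewrite spec.unlock !adjmxM adj_rdiag adjmxK mulmxA. Qed.

Lemma eq_spec n (U : 'M[C]_n) d e : d =1 e -> spec U d = spec U e.
Proof.
move=> de; suff h : rdiag d = rdiag e by rewrite spec.unlock h.
by rewrite rdiag.unlock; congr diag_mx; apply/rowP => j; rewrite !mxE de.
Qed.

Lemma specM n (U : 'M[C]_n) d e : U \is unitarymx ->
  spec U d *m spec U e = spec U (fun j => d j * e j).
Proof.
move=> uU; rewrite spec.unlock -rdiagM !mulmxA.
by rewrite -(mulmxA _ U U^H) (unitaryK uU) mulmx1.
Qed.

Lemma spec1 n (U : 'M[C]_n) : U \is unitarymx -> spec U (fun=> 1) = 1%:M.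
Proof.
move=> uU; rewrite spec.unlock; suff -> : @rdiag R n (fun=> 1) = 1%:M.
  by rewrite mulmx1 unitaryKV.
by rewrite rdiag.unlock -diag_const_mx; congr diag_mx; apply/rowP => j; rewrite !mxE.
Qed.

Lemma specZ n (U : 'M[C]_n) c d : c%:C *: spec U d = spec U (fun j => c * d j).
Proof.
suff h : c%:C *: rdiag d = rdiag (fun j => c * d j).
  by rewrite spec.unlock scalemxAl scalemxAr h.
by rewrite rdiag.unlock; apply/matrixP => i j; rewrite !mxE rmorphM mulrnAr.
Qed.

Lemma mxtrace_spec n (U : 'M[C]_n) d : U \is unitarymx ->
  \tr (spec U d) = (\sum_j d j)%:C.
Proof.
move=> uU; rewrite spec.unlock -mulmxA mxtrace_mulC -mulmxA (unitaryK uU) mulmx1.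
rewrite rdiag.unlock mxtrace_diag rmorph_sum /=.
by apply: eq_bigr => j _; rewrite mxE.
Qed.

Lemma spec_quad n p (U : 'M[C]_n) d (x : 'M_(n, p)) k :
  (x^H *m spec U d *m x) k k = \sum_j (d j)%:C * `|(U *m x) j k| ^+ 2.
Proof.
have -> : x^H *m spec U d *m x = (U *m x)^H *m (rdiag d *m (U *m x)).
  by rewrite spec.unlock adjmxM !mulmxA.
move: (U *m x) => y; rewrite mxE; apply: eq_bigr => j _.
rewrite adjmxE rdiag.unlock mul_diag_mx !mxE normCK.
by rewrite mulrCA [_^* * _]mulrC.
Qed.

(** In eigenbases the hypothesis reads [d i * W i j = W i j * e j], so
    [W i j] vanishes unless [d i = e j], and then [f] may be applied to both
    sides.  With [D] the identity this says that the functional calculus does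
    not depend on the diagonalization; with [D] invertible, that it respects
    similarity. *)
Lemma spec_intertwine f n (U V D : 'M[C]_n) d e :
  U \is unitarymx -> V \is unitarymx ->
  spec U d *m D = D *m spec V e ->
  spec U (f \o d) *m D = D *m spec V (f \o e).
Proof.
move=> uU uV h.
have hW : rdiag d *m (U *m D *m V^H) = (U *m D *m V^H) *m rdiag e.
  have := congr1 (fun M => U *m M *m V^H) h.
  by rewrite spec.unlock !mulmxA (unitaryK uU) mul1mx -!mulmxA (unitaryK uV) mulmx1.
have hfW : rdiag (f \o d) *m (U *m D *m V^H) =
           (U *m D *m V^H) *m rdiag (f \o e).
  move: (U *m D *m V^H) hW => W hW.
  rewrite !rdiag.unlock in hW *.
  apply/matrixP => i j; have := congr1 (fun M : 'M_n => M i j) hW.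
  rewrite !mul_diag_mx !mul_mx_diag !mxE /= => hij.
  have [->|W0] := eqVneq (W i j) 0; first by rewrite mulr0 mul0r.
  suff -> : d i = e j by rewrite mulrC.
  by move: hij; rewrite [RHS]mulrC => /(mulIf W0) /complexI.
have := congr1 (fun M => U^H *m M *m V) hfW.
rewrite !spec.unlock -!mulmxA (unitaryKV uV) mulmx1 => ->.
by rewrite !mulmxA (unitaryKV uU) mul1mx.
Qed.

Lemma herm_spec n (A : 'M[C]_n) : A^H = A ->
  exists U, exists2 d, U \is unitarymx &
    A = spec U d /\ forall f, mxfun f A = spec U (f \o d).
Proof.
move=> hA; have {}hA : A \is hermsymmx.
  by rewrite is_hermitianmxE expr0 scale1r -{1}hA adjmx.unlock.
exists (spectralmx A), (fun j => complex.Re (spectral_diag A 0 j)).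
  exact: spectral_unitarymx.
have uU := spectral_unitarymx A.
split=> [|f]; rewrite /mxfun !spec.unlock adjmx.unlock -(invmx_unitary uU).
  have /orthomx_spectralP {1}-> := hermitian_normalmx hA.
  congr (_ *m _ *m _); rewrite rdiag.unlock; congr diag_mx.
  apply/rowP => j; rewrite mxE.
  have /mxOverP/(_ 0 j) hr := hermitian_spectral_diag_real hA.
  by rewrite (RRe_real hr).
congr (_ *m _ *m _); rewrite rdiag.unlock; congr diag_mx.
by apply/rowP => j; rewrite !mxE.
Qed.

Lemma mxfun_spec f n (U : 'M[C]_n) d : U \is unitarymx ->
  mxfun f (spec U d) = spec U (f \o d).
Proof.
move=> uU; have /herm_spec [V [e uV [hA hf]]] := adj_spec U d.
rewrite hf; have := @spec_intertwine f n V U 1%:M e d uV uU.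
by rewrite mulmx1 mul1mx hA mulmx1 mul1mx; apply.
Qed.

Lemma rpowE n (A : 'M[C]_n) t : rpow A t = mxpowR A t.
Proof. by rewrite rpow.unlock. Qed.

Lemma rpow_spec t n (U : 'M[C]_n) d : U \is unitarymx ->
  rpow (spec U d) t = spec U (fun j => d j `^ t).
Proof. by move=> uU; rewrite rpow.unlock /mxpowR mxfun_spec. Qed.

Lemma sorting_perm n (d : 'I_n -> R) :
  exists s : 'S_n, forall i j : 'I_n, (i <= j)%N -> d (s j) <= d (s i).
Proof.
have hs : perm_eq (sort >=%O [tuple d i | i < n]) [tuple d i | i < n].
  by rewrite perm_sort.
have [s hs'] := tuple_permP hs.
exists s => i j ij.
have st : sorted >=%O (sort >=%O [tuple d i | i < n]).
  by apply: sort_sorted => x y; apply: le_total.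
rewrite hs' in st.
have /(_ _ _ i j) := sorted_leq_nth _ _ (d i) st.
rewrite !size_tuple => /(_ _ _ (ltn_ord i) (ltn_ord j) ij).
have e (k : 'I_n) : nth (d i) [tuple tnth [tuple d i0  | i0 < n] (s i0)  | i0 < n] k = d (s k).
  by rewrite -tnth_nth !tnth_mktuple.
by rewrite !e; apply => [x y z h1 h2|x] /=; [apply: le_trans h1|].
Qed.

Lemma spec_perm n (U : 'M[C]_n) d (s : 'S_n) : U \is unitarymx ->
  row_perm s U \is unitarymx /\ spec (row_perm s U) (d \o s) = spec U d.
Proof.
move=> uU; split.
  apply: unitaryE; rewrite adjmx.unlock; apply/matrixP => i j.
  have /matrixP/(_ (s i) (s j)) := unitaryK uU.
  rewrite adjmx.unlock !mxE (inj_eq perm_inj) => <-.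
  by apply: eq_bigr => k _; rewrite !mxE.
apply/matrixP => i j; rewrite spec.unlock rdiag.unlock -!mulmxA !mul_diag_mx.
rewrite mxE [RHS]mxE [RHS](reindex_inj (@perm_inj _ s)).
by apply: eq_bigr => k _; rewrite !adjmxE !mxE.
Qed.

Lemma posdefI n (A : 'M[C]_n) : A^H = A ->
  (forall x : 'cV[C]_n, x != 0 -> 0 < (x^H *m A *m x) 0 0) -> posdef A.
Proof. by rewrite posdef.unlock. Qed.

Lemma posdef_adj n (A : 'M[C]_n) : posdef A -> A^H = A.
Proof. by rewrite posdef.unlock => -[]. Qed.

Lemma posdef_gt0 n (A : 'M[C]_n) (x : 'cV[C]_n) : posdef A -> x != 0 ->
  0 < (x^H *m A *m x) 0 0.
Proof. by rewrite posdef.unlock => -[_]; apply. Qed.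

Lemma posdefmxP n (A : 'M[C]_n) : posdefmx A <-> posdef A.
Proof.
rewrite /posdefmx posdef.unlock adjmx.unlock is_hermitianmxE expr0 scale1r.
by split=> -[h1 h2]; split=> //; [rewrite -(eqP h1) | rewrite h1].
Qed.

Lemma psdI n (A : 'M[C]_n) :
  (forall x : 'cV[C]_n, 0 <= (x^H *m A *m x) 0 0) -> psd A.
Proof. by rewrite psd.unlock. Qed.

Lemma psd_ge0 n (A : 'M[C]_n) (x : 'cV[C]_n) : psd A ->
  0 <= (x^H *m A *m x) 0 0.
Proof. by rewrite psd.unlock. Qed.

Lemma posdef_psd n (A : 'M[C]_n) : posdef A -> psd A.
Proof.
move=> hA; apply: psdI => x; have [->|x0] := eqVneq x 0.
  by rewrite mulmx0 mxE.
exact: (ltW (posdef_gt0 hA x0)).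
Qed.

Lemma psdD n (A B : 'M[C]_n) : psd A -> psd B -> psd (A + B).
Proof.
by move=> hA hB; apply: psdI => x; rewrite mulmxDr mulmxDl mxE addr_ge0 ?psd_ge0.
Qed.

Lemma posdefD n (A B : 'M[C]_n) : posdef A -> posdef B -> posdef (A + B).
Proof.
move=> hA hB; apply: posdefI => [|x x0]; first by rewrite adjmxD !posdef_adj.
by rewrite mulmxDr mulmxDl mxE addr_gt0 ?posdef_gt0.
Qed.

Lemma posdef_sum n m (A : 'I_m -> 'M[C]_n) : (0 < m)%N -> (forall i, posdef (A i)) ->
  posdef (\sum_(i < m) A i).
Proof.
case: m A => // m A _ hA; elim: m A hA => [|m IH] A hA.
  by rewrite big_ord1.
by rewrite big_ord_recl; apply: posdefD; [|apply: IH].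
Qed.

Lemma psd_congr n p (A : 'M[C]_n) (S : 'M[C]_(n, p)) :
  psd A -> psd (S^H *m A *m S).
Proof.
move=> hA; apply: psdI => x; have := psd_ge0 (S *m x) hA.
by rewrite adjmxM !mulmxA.
Qed.

Lemma mulmx_unit_neq0 n (S : 'M[C]_n) (x : 'cV[C]_n) :
  S \in unitmx -> x != 0 -> S *m x != 0.
Proof.
by move=> uS; apply: contra_neq => h; rewrite -(mulKmx uS x) h mulmx0.
Qed.

Lemma posdef_congr n (A S : 'M[C]_n) : S \in unitmx -> posdef A -> posdef (S^H *m A *m S).
Proof.
move=> uS hA; apply: posdefI => [|x x0].
  by rewrite !adjmxM (posdef_adj hA) adjmxK mulmxA.
have := posdef_gt0 hA (mulmx_unit_neq0 uS x0).
by rewrite adjmxM !mulmxA.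
Qed.

Lemma posdef_congrV n (A S : 'M[C]_n) : S \in unitmx -> posdef A -> posdef (S *m A *m S^H).
Proof. by move=> uS hA; rewrite -{1}(adjmxK S); apply: posdef_congr; rewrite ?unitmx_adj. Qed.

Lemma unitary_row_norm n (U : 'M[C]_n) j : U \is unitarymx ->
  \sum_k `|U j k| ^+ 2 = 1.
Proof.
move=> /unitaryK/matrixP/(_ j j); rewrite mxE [RHS]mxE eqxx => h.
by apply: etrans h; apply: eq_bigr => k _; rewrite adjmxE normCK.
Qed.

Lemma psd_spec n (U : 'M[C]_n) d : (forall j, 0 <= d j) -> psd (spec U d).
Proof.
move=> d0; apply: psdI => x; rewrite spec_quad sumr_ge0 // => j _.
by rewrite mulr_ge0 ?exprn_ge0 // lecR.
Qed.

Lemma spec_posdef n (U : 'M[C]_n) d : U \is unitarymx -> (forall j, 0 < d j) ->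
  posdef (spec U d).
Proof.
move=> uU d0; apply: posdefI => [|x x0]; first exact: adj_spec.
have psdU : psd (spec U d) by apply: psd_spec => j; apply: ltW.
rewrite lt0r psd_ge0 // andbT.
apply: contra_neq x0; rewrite spec_quad => /eqP.
rewrite psumr_eq0 => [/allP h|j _]; last first.
  by rewrite mulr_ge0 ?exprn_ge0 // lecR ltW.
have uu : U \in unitmx by apply: unitarymx_unit.
rewrite -(mulKmx uu x); suff -> : U *m x = 0 by rewrite mulmx0.
apply/matrixP => j k; rewrite ord1 [RHS]mxE.
have := h j (mem_index_enum j).
rewrite mulf_eq0 expf_eq0 /= normr_eq0 => /orP[|/eqP//].
by rewrite eq_complex /= eqxx andbT (gt_eqF (d0 j)).
Qed.

(** The eigenvalues come in decreasing order, as needed to compare partial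
    products. *)
Lemma posdef_spec n (A : 'M[C]_n) : posdef A -> exists U, exists d,
  [/\ U \is unitarymx, forall j, 0 < d j,
      forall i j : 'I_n, (i <= j)%N -> d j <= d i & A = spec U d].
Proof.
move=> pA; have [U [d uU [eA _]]] := herm_spec (posdef_adj pA).
have d0 j : 0 < d j.
  have uu : U^H \in unitmx by rewrite unitmx_adj unitarymx_unit.
  have e0 : (delta_mx j 0 : 'cV[C]_n) != 0.
    apply/eqP => /matrixP/(_ j 0); rewrite !mxE !eqxx => /eqP.
    by rewrite oner_eq0.
  have := posdef_gt0 pA (mulmx_unit_neq0 uu e0).
  rewrite eA spec_quad mulmxA (unitaryK uU) mul1mx (bigD1 j) //= big1.
    by rewrite mxE !eqxx normr1 expr1n mulr1 addr0 ltcR.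
  by move=> k /negPf kj; rewrite mxE kj normr0 expr0n mulr0.
have [s hs] := sorting_perm d.
have [uV eV] := spec_perm d s uU.
by exists (row_perm s U), (d \o s); split=> [//|j|//|]; [exact: d0|rewrite eV].
Qed.

Lemma posdef_rpow n (A : 'M[C]_n) t : posdef A -> posdef (rpow A t).
Proof.
move=> /posdef_spec[U [d [uU d0 _ ->]]]; rewrite rpow_spec //.
by apply: spec_posdef => // j; rewrite powR_gt0.
Qed.

Lemma rpow_adj n (A : 'M[C]_n) t : posdef A -> (rpow A t)^H = rpow A t.
Proof. by move=> /(posdef_rpow t)/posdef_adj. Qed.

Lemma rpowD n (A : 'M[C]_n) s t : posdef A ->
  rpow A s *m rpow A t = rpow A (s + t).
Proof.
move=> /posdef_spec[U [d [uU d0 _ ->]]]; rewrite !rpow_spec // specM //.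
by apply: eq_spec => j; rewrite powRD // (gt_eqF (d0 j)) implybT.
Qed.

Lemma rpow0 n (A : 'M[C]_n) : posdef A -> rpow A 0 = 1%:M.
Proof.
move=> /posdef_spec[U [d [uU d0 _ ->]]]; rewrite rpow_spec // -(spec1 uU).
by apply: eq_spec => j; rewrite powRr0.
Qed.

Lemma rpow1 n (A : 'M[C]_n) : posdef A -> rpow A 1 = A.
Proof.
move=> /posdef_spec[U [d [uU d0 _ ->]]]; rewrite rpow_spec //.
by apply: eq_spec => j; rewrite powRr1 // ltW.
Qed.

Lemma rpow2 n (A : 'M[C]_n) : posdef A -> rpow A 2 = A *m A.
Proof. by move=> hA; rewrite -[in RHS](rpow1 hA) rpowD. Qed.

Lemma rpowM n (A : 'M[C]_n) s t : posdef A -> rpow (rpow A s) t = rpow A (s * t).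
Proof.
move=> /posdef_spec[U [d [uU d0 _ ->]]]; rewrite !rpow_spec //.
by apply: eq_spec => j; rewrite powRrM.
Qed.

Lemma rpowN n (A : 'M[C]_n) t : posdef A -> rpow A t *m rpow A (- t) = 1%:M.
Proof. by move=> hA; rewrite rpowD // subrr rpow0. Qed.

Lemma rpow_unit n (A : 'M[C]_n) t : posdef A -> rpow A t \in unitmx.
Proof. by move=> /(rpowN t)/mulmx1_unit[]. Qed.

Lemma posdef_unit n (A : 'M[C]_n) : posdef A -> A \in unitmx.
Proof. by move=> hA; rewrite -(rpow1 hA) rpow_unit. Qed.

Lemma posdef1 n : posdef (1%:M : 'M[C]_n).
Proof.
have u1 : (1%:M : 'M[C]_n) \is unitarymx by apply: unitaryE; rewrite adjmx1 mulmx1.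
by rewrite -(spec1 u1); apply: spec_posdef.
Qed.

Lemma posdef_gram n (X : 'M[C]_n) : X \in unitmx -> posdef (X *m X^H).
Proof. by move=> uX; rewrite -{1}(mulmx1 X); apply: (posdef_congrV uX (posdef1 n)). Qed.

Lemma posdef_gramV n (X : 'M[C]_n) : X \in unitmx -> posdef (X^H *m X).
Proof. by move=> uX; rewrite -{2}(mul1mx X) mulmxA; apply: (posdef_congr uX (posdef1 n)). Qed.

Lemma rpow_intertwine n (A B D : 'M[C]_n) t : posdef A -> posdef B ->
  A *m D = D *m B -> rpow A t *m D = D *m rpow B t.
Proof.
move=> /posdef_spec[U [d [uU _ _ ->]]] /posdef_spec[V [e [uV _ _ ->]]] h.
rewrite (rpow_spec t d uU) (rpow_spec t e uV).
exact: (spec_intertwine (fun a => a `^ t) uU uV h).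
Qed.

Definition trpow n (A : 'M[C]_n) (t : R) : R := complex.Re (\tr (rpow A t)).

Lemma trpow_spec n (U : 'M[C]_n) d t : U \is unitarymx ->
  trpow (spec U d) t = \sum_j d j `^ t.
Proof. by move=> uU; rewrite /trpow rpow_spec // mxtrace_spec. Qed.

Lemma trpowE n (A : 'M[C]_n) t : posdef A -> \tr (rpow A t) = (trpow A t)%:C.
Proof.
move=> /posdef_spec[U [d [uU _ _ ->]]].
rewrite (trpow_spec _ _ uU) (rpow_spec _ _ uU) (mxtrace_spec _ uU).
by [].
Qed.

Lemma trpow_ge0 n (A : 'M[C]_n) t : posdef A -> 0 <= trpow A t.
Proof.
move=> /posdef_spec[U [d [uU _ _ ->]]].
by rewrite trpow_spec // sumr_ge0 // => j _; apply: powR_ge0.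
Qed.

Lemma trpow_rpow n (A : 'M[C]_n) s t : posdef A -> trpow (rpow A s) t = trpow A (s * t).
Proof. by move=> hA; rewrite /trpow rpowM. Qed.

Lemma trpow_similar n (A B D : 'M[C]_n) t : posdef A -> posdef B -> D \in unitmx ->
  A *m D = D *m B -> trpow A t = trpow B t.
Proof.
move=> hA hB uD h; have e := rpow_intertwine t hA hB h.
rewrite /trpow -(mulmxK uD (rpow A t)) e -mulmxA mxtrace_mulC -mulmxA.
by rewrite mulVmx // mulmx1.
Qed.

Lemma tracenormE n (A : 'M[C]_n) : posdef A -> tracenorm A = \tr A.
Proof.
move=> hA; have hA' := posdef_adj hA; rewrite /tracenorm /absmx.
have -> : A ^t* *m A = rpow A 2 by rewrite rpow2 // -[X in _ = X *m _]hA' adjmx.unlock.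
by rewrite -rpowE rpowM // mulrC mul1r mulVf ?rpow1 // pnatr_eq0.
Qed.

End Calculus.

(** * Determinant inequalities and log-majorization of eigenvalues *)

(** Summing over all maps ['I_k -> 'I_n], instead of over increasing ones,
    avoids any choice of representatives: the non-injective maps contribute
    zero and every [k]-subset is counted [k`!] times.  Expanding
    [\det (A *m B)] by rows gives one such sum, and composing the maps with a
    permutation of ['I_k] gives [k`!] copies of it. *)
Lemma cauchy_binet (F : comNzRingType) k n (A : 'M[F]_(k, n)) (B : 'M[F]_(n, k)) :
  (k`!)%:R * \det (A *m B) =
  \sum_(f : {ffun 'I_k -> 'I_n}) \det (colsub f A) * \det (rowsub f B).
Proof.
have expand : \det (A *m B) =
    \sum_(f : {ffun 'I_k -> 'I_n}) (\prod_i A i (f i)) * \det (rowsub f B).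
  pose AB (s : 'S_k) i j := A i j * B j (s i).
  transitivity (\sum_(f : {ffun 'I_k -> 'I_n})
      \sum_(s : 'S_k) (-1) ^+ s * \prod_i AB s i (f i)).
    rewrite exchange_big; apply: eq_bigr => /= s _; rewrite -big_distrr /=.
    congr (_ * _); rewrite -(bigA_distr_bigA (AB s)) /=.
    by apply: eq_bigr => x _; rewrite mxE.
  apply: eq_bigr => f _; rewrite big_distrr; apply: eq_bigr => s _ /=.
  rewrite [RHS]mulrCA; congr (_ * _); rewrite big_split; congr (_ * _).
  by apply: eq_bigr => i _; rewrite mxE.
transitivity (\sum_(s : 'S_k) \det (A *m B)).
  by rewrite sumr_const card_Sn mulr_natl.
under [RHS]eq_bigr => f _ do rewrite big_distrl /=.
rewrite [RHS]exchange_big; apply: eq_bigr => s _ /=.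
rewrite expand; pose g (t : 'S_k) (f : {ffun 'I_k -> 'I_n}) := [ffun i => f (t i)].
have gK : cancel (g s) (g s^-1%g).
  by move=> f; apply/ffunP => i; rewrite !ffunE permKV.
have gK' : cancel (g s^-1%g) (g s).
  by move=> f; apply/ffunP => i; rewrite !ffunE permK.
rewrite (reindex (g s)) /=; last by exists (g s^-1%g) => f _.
apply: eq_bigr => f _.
have -> : rowsub (g s f) B = row_perm s (rowsub f B).
  by apply/matrixP => i j; rewrite !mxE ffunE.
rewrite row_permE det_mulmx det_perm mulrA; congr (_ * _).
rewrite mulrC; congr (_ * _); apply: eq_bigr => i _.
by rewrite mxE ffunE.
Qed.

Section Minors.
Variable R : realType.
Notation C := R[i].

Lemma sum_cauchy_schwarz (T : finType) (a b : T -> C) :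
  `|\sum_t (a t)^* * b t| ^+ 2 <=
  (\sum_t `|a t| ^+ 2) * (\sum_t `|b t| ^+ 2).
Proof.
pose u := \row_(j < #|T|) b (enum_val j); pose v := \row_(j < #|T|) a (enum_val j).
have h : `|dotmx u v| ^+ 2 <= dotmx u u * dotmx v v.
  by have [] := CauchySchwarz (@dotmx C #|T|) u v.
have toT (F : T -> C) : \sum_(j < #|T|) F (enum_val j) = \sum_t F t.
  by rewrite [RHS](reindex _ (onW_bij _ (enum_val_bij T))).
have dotE (x y : T -> C) : dotmx (\row_(j < #|T|) x (enum_val j))
   (\row_(j < #|T|) y (enum_val j)) = \sum_t (y t)^* * x t.
  rewrite dotmxE mxE -toT; apply: eq_bigr => j _.
  by rewrite !mxE mulrC.
move: h; rewrite /u /v !dotE mulrC => h; apply: le_trans h _.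
rewrite le_eqVlt; apply/orP; left; apply/eqP.
by congr (_ * _); apply: eq_bigr => t _; rewrite normCKC.
Qed.

Lemma det_adj k (A : 'M[C]_k) : \det A^H = (\det A)^*.
Proof. by rewrite adjmx.unlock det_map_mx det_tr. Qed.

(** A Gram determinant is an inner product of vectors of minors; this makes
    the next inequality an instance of the Cauchy-Schwarz inequality. *)
Lemma gram_binet k n (P Q : 'M[C]_(n, k)) :
  \det (P^H *m Q) = (k`!)%:R^-1 *
  \sum_(f : {ffun 'I_k -> 'I_n}) (\det (rowsub f P))^* * \det (rowsub f Q).
Proof.
have k0 : (k`!)%:R != 0 :> C by rewrite pnatr_eq0 -lt0n fact_gt0.
apply: (canRL (mulKf k0)); rewrite cauchy_binet; apply: eq_bigr => f _.
congr (_ * _); rewrite -det_adj; congr (\det _); apply/matrixP => i j.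
by rewrite mxE !adjmxE mxE.
Qed.

Lemma invfact_ge0 k : 0 <= (k`!)%:R^-1 :> C.
Proof. by rewrite invr_ge0 ler0n. Qed.

Lemma det_cauchy_schwarz k n (P Q : 'M[C]_(n, k)) :
  `|\det (P^H *m Q)| ^+ 2 <= \det (P^H *m P) * \det (Q^H *m Q).
Proof.
rewrite (gram_binet P Q) (gram_binet P P) (gram_binet Q Q).
move: (_^-1) (invfact_ge0 k) => c c0.
rewrite normrM (ger0_norm c0) exprMn [X in _ <= X]mulrACA -[c * c]expr2.
rewrite ler_wpM2l ?exprn_ge0 //; apply: le_trans (sum_cauchy_schwarz _ _) _.
rewrite le_eqVlt; apply/orP; left; apply/eqP.
by congr (_ * _); apply: eq_bigr => f _; rewrite normCKC.
Qed.

(** Cancel the common indices of the image [A] of [f] and of the initial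
    segment [B]: what remains of [A] lies beyond [B], where [d] is smaller,
    and both remainders have the same size. *)
Lemma top_prod n k (d : 'I_n -> R) (f : {ffun 'I_k -> 'I_n}) :
  (forall j, 0 < d j) -> (forall i j : 'I_n, (i <= j)%N -> d j <= d i) ->
  injective f -> \prod_i d (f i) <= \prod_(j < n | (j < k)%N) d j.
Proof.
case: k f => [|k] f d0 hd fi.
  by rewrite big_ord0 big_pred0.
have kn : (k < n)%N by have := leq_card f fi; rewrite !card_ord.
pose A := f @: setT; pose B := [set j : 'I_n | (j < k.+1)%N].
have cA : #|A| = k.+1 by rewrite card_imset // cardsT card_ord.
have cB : #|B| = k.+1.
  have -> : B = [set widen_ord kn i | i : 'I_k.+1].
    apply/setP => j; rewrite inE; apply/idP/imsetP => [jk|[i _ ->]].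
      by exists (Ordinal jk) => //; apply: val_inj.
    by rewrite /= ltn_ord.
  rewrite card_imset ?cardT ?size_enum_ord // => i j /(congr1 val) /= ij.
  exact: val_inj.
have -> : \prod_i d (f i) = \prod_(j in A) d j.
  by rewrite big_imset /=; [apply: eq_bigl => i; rewrite inE | move=> i j _ _ /fi].
have -> : \prod_(j < n | (j < k.+1)%N) d j = \prod_(j in B) d j.
  by apply: eq_bigl => j; rewrite inE.
rewrite (big_setID B) [X in _ <= X](big_setID A) /= setIC.
rewrite ler_wpM2l //; first by rewrite prodr_ge0 // => j _; apply: ltW.
have cD : #|A :\: B| = #|B :\: A|.
  apply/eqP; rewrite -(eqn_add2l #|A :&: B|) cardsID setIC cardsID cA cB.
  by [].
(* Indices start at 0, so mu is the last value inside B. *)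
pose mu := d (Ordinal kn).
apply: (@le_trans _ _ (mu ^+ #|A :\: B|)).
  rewrite -prodr_const; apply: ler_prod => j.
  rewrite !inE -leqNgt => /andP[kj _]; rewrite ltW ?d0 //=.
  by apply: hd; apply: ltnW.
rewrite cD -prodr_const; apply: ler_prod => j.
rewrite !inE => /andP[_ jk]; rewrite ltW ?d0 //=.
by apply: hd; rewrite -ltnS.
Qed.

Lemma det_rdiag k (d : 'I_k -> R) : \det (rdiag d) = (\prod_i d i)%:C.
Proof.
rewrite rdiag.unlock det_diag rmorph_prod /=.
by apply: eq_bigr => i _; rewrite mxE.
Qed.

(** By the Cauchy-Binet formula the left side is an average of products of [k]
    distinct eigenvalues, with the nonnegative weights whose sum is
    [\det (S^H *m S)]. *)
Lemma det_compression k n (U : 'M[C]_n) (d : 'I_n -> R) (S : 'M[C]_(n, k)) :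
  U \is unitarymx ->
  (forall j, 0 < d j) -> (forall i j : 'I_n, (i <= j)%N -> d j <= d i) ->
  \det (S^H *m spec U d *m S) <=
  (\prod_(j < n | (j < k)%N) d j)%:C * \det (S^H *m S).
Proof.
move=> uU d0 hd; pose Z := U *m S.
have -> : S^H *m spec U d *m S = Z^H *m (rdiag d *m Z).
  by rewrite /Z adjmxM spec.unlock !mulmxA.
have -> : S^H *m S = Z^H *m Z.
  by rewrite /Z adjmxM -mulmxA (mulmxA U^H) (unitaryKV uU) mul1mx.
rewrite (gram_binet Z Z) (gram_binet Z (rdiag d *m Z)) mulrCA.
rewrite ler_wpM2l ?invfact_ge0 // mulr_sumr.
apply: ler_sum => f _.
have -> : rowsub f (rdiag d *m Z) = rdiag (d \o f) *m rowsub f Z.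
  by apply/matrixP => i j; rewrite rdiag.unlock !mul_diag_mx !mxE.
rewrite det_mulmx det_rdiag mulrCA -normCKC.
have [/injectiveP fi|/injectivePn[i1 [i2 Di Ef]]] := boolP (injectiveb f).
  by rewrite ler_wpM2r ?exprn_ge0 // lecR top_prod.
suff -> : \det (rowsub f Z) = 0 by rewrite normr0 expr0n /= !mulr0.
by apply: (determinant_alternate Di) => j; rewrite !mxE Ef.
Qed.

Lemma posdef_det n (A : 'M[C]_n) : posdef A -> 0 < \det A.
Proof.
move=> /posdef_spec[U [d [uU d0 _ ->]]].
rewrite spec.unlock -mulmxA det_mulmx mulrC -det_mulmx -mulmxA (unitaryK uU) mulmx1.
by rewrite det_rdiag ltcR prodr_gt0.
Qed.

(** [X *m Y] has the eigenvalues [l] of [N], with eigenvectors the columns of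
    [D *m W^H].  For [S] the first [k] of them, [\det (S^H *m X *m Y *m S)] is
    [\det (S^H *m S)] times the product of the first [k] eigenvalues; estimate
    it by [det_cauchy_schwarz] and then each factor by [det_compression]. *)
Lemma eigen_prod_le n (X Y N D W U V : 'M[C]_n) (l d e : 'I_n -> R) k :
  W \is unitarymx -> U \is unitarymx -> V \is unitarymx ->
  (forall j, 0 < l j) -> (forall j, 0 < d j) -> (forall j, 0 < e j) ->
  (forall i j : 'I_n, (i <= j)%N -> d j <= d i) ->
  (forall i j : 'I_n, (i <= j)%N -> e j <= e i) ->
  N = spec W l -> X *m X^H = spec U d -> Y^H *m Y = spec V e ->
  D \in unitmx -> X *m Y *m D = D *m N -> (k <= n)%N ->
  (\prod_(j < n | (j < k)%N) l j) ^+ 2 <=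
  (\prod_(j < n | (j < k)%N) d j) * (\prod_(j < n | (j < k)%N) e j).
Proof.
move=> uW uU uV l0 d0 e0 sd se eN eX eY uD h kn.
(* Multiplication by E on the right keeps the first k columns. *)
pose E : 'M[C]_(n, k) := \matrix_(i, j) (i == j :> nat)%:R.
pose lk i := l (widen_ord kn i).
have El : rdiag l *m E = E *m rdiag lk.
  rewrite !rdiag.unlock mul_diag_mx mul_mx_diag; apply/matrixP => i j.
  rewrite !mxE /lk; have [ij|ij] := eqVneq (i : nat) j.
    by rewrite mulr1 mul1r; congr ((l _)%:C); apply: val_inj.
  by rewrite mulr0 mul0r.
pose M := D *m W^H; pose S := M *m E.
have uM : M \in unitmx.
  by rewrite /M unitmx_mul uD unitmx_adj (unitarymx_unit uW).
have XYM : X *m Y *m M = M *m rdiag l.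
  rewrite /M mulmxA h eN spec.unlock -!mulmxA (unitaryK uW) mulmx1 //.
have XYS : X *m Y *m S = S *m rdiag lk.
  by rewrite /S mulmxA XYM -mulmxA El mulmxA.
have EE : E^H *m E = 1%:M.
  apply/matrixP => i j; rewrite mxE (bigD1 (widen_ord kn i)) //= big1.
    by rewrite adjmxE !mxE /= eqxx conjC1 mul1r addr0.
  move=> t ti; rewrite adjmxE !mxE.
  have [ij|] := eqVneq (t : nat) i; last by rewrite conjC0 mul0r.
  by case/eqP: ti; apply: val_inj.
have pdS : posdef (S^H *m S).
  apply: posdefI => [|x x0]; first by rewrite adjmxM adjmxK.
  have Ex0 : E *m x != 0.
    by apply: contra_neq x0 => Ex; rewrite -(mul1mx x) -EE -mulmxA Ex mulmx0.
  by have := posdef_gt0 (posdef_gramV uM) Ex0; rewrite /S !adjmxM !mulmxA.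
have dS := posdef_det pdS.
clearbody S.
have := det_cauchy_schwarz (X^H *m S) (Y *m S).
rewrite !adjmxM adjmxK.
have -> : S^H *m X *m (Y *m S) = S^H *m S *m rdiag lk.
  by rewrite -!mulmxA -XYS !mulmxA.
have -> : S^H *m X *m (X^H *m S) = S^H *m spec U d *m S by rewrite -eX !mulmxA.
have -> : S^H *m Y^H *m (Y *m S) = S^H *m spec V e *m S by rewrite -eY !mulmxA.
rewrite det_mulmx det_rdiag normrM exprMn (gtr0_norm dS) => hle.
have h1 := det_compression S uU d0 sd; have h2 := det_compression S uV e0 se.
have ge0 (Q : 'M[C]_n) (c : 'I_n -> R) : Q \is unitarymx ->
   (forall j, 0 < c j) -> 0 <= \det (S^H *m spec Q c *m S).
  move=> uQ c0; apply/ltW/posdef_det; apply: posdefI => [|x x0].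
    by rewrite !adjmxM adj_spec adjmxK mulmxA.
  have Sx0 : S *m x != 0.
    apply: contraTneq (posdef_gt0 pdS x0) => Sx.
    by rewrite -!mulmxA Sx !mulmx0 mxE ltxx.
  by have := posdef_gt0 (spec_posdef uQ c0) Sx0; rewrite !adjmxM !mulmxA.
have := le_trans hle (ler_pM (ge0 _ _ uU d0) (ge0 _ _ uV e0) h1 h2).
have -> : forall a b c : C, a * c * (b * c) = c ^+ 2 * (a * b) by move=> *; ring.
rewrite ler_pM2l ?exprn_gt0 // -rmorphM /= ger0_norm; last first.
  by rewrite lecR prodr_ge0 // => i _; apply/ltW/l0.
have -> : \prod_(j < n | (j < k)%N) l j = \prod_i lk i by rewrite (big_ord_narrow kn).
by rewrite -rmorphXn /= lecR.
Qed.

End Minors.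

(** * From log-majorization to traces of powers *)

Section Scalars.
Variable R : realType.

(** Summation by parts; the lower bound [mu] on the weights is what makes the
    induction on [n] go through, since the last weight bounds the others from
    below. *)
Lemma abel_sum_le n (w l : 'I_n -> R) (mu : R) :
  (forall i j : 'I_n, (i <= j)%N -> w j <= w i) ->
  (forall k, (k <= n)%N -> 0 <= \sum_(j < n | (j < k)%N) l j) ->
  (forall j, mu <= w j) -> mu * \sum_j l j <= \sum_j w j * l j.
Proof.
elim: n w l mu => [|n IH] w l mu hw hl hmu; first by rewrite !big_ord0 mulr0.
have narrow k : (k <= n)%N ->
    \sum_(j < n | (j < k)%N) l (widen_ord (leqnSn n) j) = \sum_(j < n.+1 | (j < k)%N) l j.
  move=> kn; rewrite big_mkcond [RHS]big_mkcond big_ord_recr /= ltnNge kn /= addr0.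
  by apply: eq_bigr.
have S0 : 0 <= \sum_j l j.
  by have := hl n.+1 (leqnn _); under eq_bigl => j do rewrite ltn_ord.
apply: (@le_trans _ _ (w ord_max * \sum_j l j)).
  by rewrite ler_wpM2r.
rewrite !big_ord_recr /= mulrDr lerD2r.
apply: IH => [i j ij|k kn|j]; first exact: hw.
  by rewrite narrow ?hl // leqW.
by apply: hw; rewrite /= ltnW.
Qed.

Lemma ln_prod n (P : pred 'I_n) (c : 'I_n -> R) : (forall j, 0 < c j) ->
  ln (\prod_(j < n | P j) c j) = \sum_(j < n | P j) ln (c j).
Proof.
move=> c0; have [] : 0 < \prod_(j < n | P j) c j /\
  ln (\prod_(j < n | P j) c j) = \sum_(j < n | P j) ln (c j); last by [].
elim/big_ind2 : _ => [|x1 x2 y1 y2 [h1 h2] [h3 h4]|j _] //; first by rewrite ln1.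
by rewrite mulr_gt0 // lnM ?posrE // h2 h4.
Qed.

(** The graph of [exp] lies above its tangent, here taken at
    [rho * ln x]. *)
Lemma powR_tangent (x y rho : R) : 0 < x -> 0 < y ->
  x `^ rho + rho * (x `^ rho * (ln y - ln x)) <= y `^ rho.
Proof.
move=> x0 y0; have := expR_ge1Dx (rho * (ln y - ln x)).
have -> : sequences.expR (rho * (ln y - ln x)) = y `^ rho / x `^ rho.
  by rewrite mulrBr expRB /powR !gt_eqF.
rewrite ler_pdivlMr ?powR_gt0 //; nra.
Qed.

Lemma powR_le2 (x y r : R) : 0 <= r -> 0 <= x -> x <= y -> x `^ r <= y `^ r.
Proof.
by move=> r0 x0 xy; apply: ge0_ler_powR; rewrite ?nnegrE //; apply: le_trans xy.
Qed.

(** The tangent inequality bounds the difference of the two sums from below by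
    a sum of [ln (c j) - ln (l j)] with the decreasing weights
    [l j `^ rho]; its partial sums without weights are nonnegative by
    hypothesis. *)
Lemma weak_log_majorization n (l c : 'I_n -> R) (rho : R) :
  0 <= rho -> (forall j, 0 < l j) -> (forall j, 0 < c j) ->
  (forall i j : 'I_n, (i <= j)%N -> l j <= l i) ->
  (forall k, (k <= n)%N ->
    \prod_(j < n | (j < k)%N) l j <= \prod_(j < n | (j < k)%N) c j) ->
  \sum_j l j `^ rho <= \sum_j c j `^ rho.
Proof.
move=> rho0 l0 c0 sl h.
have hw : 0 <= \sum_j l j `^ rho * (ln (c j) - ln (l j)).
  have := @abel_sum_le n (fun j => l j `^ rho) (fun j => ln (c j) - ln (l j)) 0.
  rewrite mul0r; apply.
  - by move=> i j ij; apply: powR_le2 => //; [apply: ltW|apply: sl].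
  - move=> k kn; rewrite sumrB subr_ge0 -!ln_prod // ler_ln ?posrE ?h //;
      by rewrite prodr_gt0.
  - by move=> j; apply: powR_ge0.
apply: (@le_trans _ _
  (\sum_j (l j `^ rho + rho * (l j `^ rho * (ln (c j) - ln (l j)))))).
  by rewrite big_split /= lerDl -mulr_sumr mulr_ge0.
by apply: ler_sum => j _; apply: powR_tangent.
Qed.

(** The weighted mean of the tangent inequalities at the geometric mean
    [m]. *)
Lemma young (u v th : R) : 0 < u -> 0 < v -> 0 <= th <= 1 ->
  u `^ th * v `^ (1 - th) <= th * u + (1 - th) * v.
Proof.
move=> u0 v0 /andP[t0 t1]; set m := u `^ th * v `^ (1 - th).
have m0 : 0 < m by rewrite mulr_gt0 ?powR_gt0.
have lm : ln m = th * ln u + (1 - th) * ln v.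
  by rewrite lnM ?posrE ?powR_gt0 // !ln_powR.
have := powR_tangent 1 m0 u0; have := powR_tangent 1 m0 v0.
rewrite (powRr1 (ltW m0)) (powRr1 (ltW u0)) (powRr1 (ltW v0)) !mul1r lm => h1 h2.
have := ler_wpM2l t0 h2; have : 0 <= 1 - th by lra.
by move=> t1' h3; have := ler_wpM2l t1' h1; nra.
Qed.

Lemma jensen_powR n (w tau : 'I_n -> R) (v : R) : 1 <= v ->
  (forall k, 0 <= w k) -> \sum_k w k = 1 -> (forall k, 0 < tau k) ->
  (\sum_k w k * tau k) `^ v <= \sum_k w k * tau k `^ v.
Proof.
move=> v1 w0 w1 tau0; set m := \sum_k w k * tau k.
have v0 : 0 < v by lra.
have mge0 : 0 <= m by rewrite sumr_ge0 // => k _; rewrite mulr_ge0 // ltW.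
have [m0|] := ltP 0 m; last first.
  move=> mle0; have -> : m = 0 by apply/eqP; rewrite eq_le mle0.
  rewrite powR0 ?gt_eqF // sumr_ge0 // => k _.
  by rewrite mulr_ge0 ?powR_ge0.
(* Young's inequality with weight 1 / v for the v-th powers of tau k and m;
   its mean over k is the claim multiplied by 1 / v. *)
have hv : 0 <= v^-1 <= 1 by rewrite invr_ge0 ltW //= invf_le1.
have key k : tau k * m `^ (v - 1) <= v^-1 * tau k `^ v + (1 - v^-1) * m `^ v.
  have := young (powR_gt0 v (tau0 k)) (powR_gt0 v m0) hv.
  by rewrite -!powRrM mulfV ?gt_eqF // (powRr1 (ltW (tau0 k))) mulrBr mulr1 mulfV ?gt_eqF.
have : \sum_k w k * (tau k * m `^ (v - 1)) <=
       \sum_k w k * (v^-1 * tau k `^ v + (1 - v^-1) * m `^ v).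
  by apply: ler_sum => k _; rewrite ler_wpM2l.
have -> : \sum_k w k * (tau k * m `^ (v - 1)) = m `^ v.
  under eq_bigr do rewrite mulrA; rewrite -mulr_suml.
  by rewrite mulr_powRB1.
have -> : \sum_k w k * (v^-1 * tau k `^ v + (1 - v^-1) * m `^ v) =
    v^-1 * (\sum_k w k * tau k `^ v) + (1 - v^-1) * m `^ v.
  under eq_bigr do rewrite mulrDr; rewrite big_split /= -mulr_suml w1 mul1r.
  by congr (_ + _); rewrite mulr_sumr; apply: eq_bigr => k _; rewrite mulrCA.
rewrite -lerBlDr mulrBl mul1r opprB addrC subrK.
by rewrite ler_pM2l ?invr_gt0.
Qed.

End Scalars.

Section TraceInequalities.
Variable R : realType.
Notation C := R[i].

Lemma product_unit n (X Y N D : 'M[C]_n) : posdef N -> D \in unitmx ->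
  X *m Y *m D = D *m N -> X \in unitmx /\ Y \in unitmx.
Proof.
move=> pN uD h; have : X *m Y *m D \in unitmx.
  by rewrite h unitmx_mul uD posdef_unit.
by rewrite !unitmx_mul => /andP[/andP[]].
Qed.

Lemma trpow_product n (X Y N D U V : 'M[C]_n) (d e : 'I_n -> R) rho :
  0 <= rho -> U \is unitarymx -> V \is unitarymx ->
  (forall j, 0 < d j) -> (forall j, 0 < e j) ->
  (forall i j : 'I_n, (i <= j)%N -> d j <= d i) ->
  (forall i j : 'I_n, (i <= j)%N -> e j <= e i) ->
  X *m X^H = spec U d -> Y^H *m Y = spec V e ->
  posdef N -> D \in unitmx -> X *m Y *m D = D *m N ->
  trpow N rho <= \sum_j (d j * e j) `^ (rho / 2).
Proof.
move=> rho0 uU uV d0 e0 sd se eX eY pN uD h.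
have [W [l [uW l0 sl eN]]] := posdef_spec pN.
rewrite eN trpow_spec //.
have -> : \sum_j l j `^ rho = \sum_j (l j ^+ 2) `^ (rho / 2).
  apply: eq_bigr => j _; rewrite -powR_mulrn ?ltW // -powRrM.
  by congr (_ `^ _); field.
apply: weak_log_majorization.
- by rewrite divr_ge0.
- by move=> j; rewrite exprn_gt0.
- by move=> j; rewrite mulr_gt0.
- by move=> i j ij; apply: lerXn2r; rewrite ?nnegrE; [apply: ltW|apply: ltW|apply: sl].
move=> k kn; rewrite prodrXl big_split /=.
exact: (eigen_prod_le uW uU uV l0 d0 e0 sd se eN eX eY uD h kn).
Qed.

(** The exponents are written so that their reciprocals are proportional to
    [t1] and [t2]: this is Hoelder's inequality for the singular values of
    [X] and [Y], with exponents [2 * c / t1] and [2 * c / t2], in its additive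
    form. *)
Lemma trpow_holder n (X Y N D : 'M[C]_n) (t1 t2 c : R) :
  0 < t1 -> 0 < t2 -> 0 < c ->
  posdef N -> D \in unitmx -> X *m Y *m D = D *m N ->
  trpow N (2 * c / (t1 + t2)) <=
  t1 / (t1 + t2) * trpow (X *m X^H) (c / t1) +
  t2 / (t1 + t2) * trpow (Y^H *m Y) (c / t2).
Proof.
move=> t10 t20 c0 pN uD h; have [uX uY] := product_unit pN uD h.
have [U [d [uU d0 sd eX]]] := posdef_spec (posdef_gram uX).
have [V [e [uV e0 se eY]]] := posdef_spec (posdef_gramV uY).
have t0 : 0 < t1 + t2 by lra.
have rho0 : 0 <= 2 * c / (t1 + t2) by rewrite divr_ge0 ?mulr_ge0 // ltW.
have := trpow_product rho0 uU uV d0 e0 sd se eX eY pN uD h.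
move=> h1; apply: le_trans h1 _.
rewrite eX eY (trpow_spec _ _ uU) (trpow_spec _ _ uV) !mulr_sumr -big_split /=.
apply: ler_sum => j _.
have th : 0 <= t1 / (t1 + t2) <= 1.
  apply/andP; split; first by apply: divr_ge0; apply: ltW.
  by rewrite ler_pdivrMr // mul1r; lra.
have := young (powR_gt0 (c / t1) (d0 j)) (powR_gt0 (c / t2) (e0 j)) th.
have -> : 1 - t1 / (t1 + t2) = t2 / (t1 + t2) by field; rewrite gt_eqF.
move=> h2; apply: le_trans h2; rewrite (powRM _ (ltW (d0 j)) (ltW (e0 j))) -!powRrM.
have -> : c / t1 * (t1 / (t1 + t2)) = 2 * c / (t1 + t2) / 2.
  by field; rewrite !gt_eqF.
have -> : c / t2 * (t2 / (t1 + t2)) = 2 * c / (t1 + t2) / 2.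
  by field; rewrite !gt_eqF.
by [].
Qed.

Lemma psd_spec_ge0 n (U : 'M[C]_n) (d : 'I_n -> R) : U \is unitarymx ->
  psd (spec U d) -> forall j, 0 <= d j.
Proof.
move=> uU h j; have := psd_ge0 (U^H *m delta_mx j 0) h.
rewrite spec_quad mulmxA (unitaryK uU) mul1mx (bigD1 j) //= big1.
  by rewrite mxE !eqxx normr1 expr1n mulr1 addr0 lecR.
by move=> k /negPf kj; rewrite mxE kj normr0 expr0n mulr0.
Qed.

Lemma sub1_spec n (U : 'M[C]_n) (d : 'I_n -> R) : U \is unitarymx ->
  1%:M - spec U d = spec U (fun j => 1 - d j).
Proof.
move=> uU; rewrite -(spec1 uU) spec.unlock -mulmxBl -mulmxBr.
congr (_ *m _ *m _); rewrite rdiag.unlock -raddfB; congr diag_mx.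
by apply/rowP => j; rewrite !mxE -rmorphB.
Qed.

(** The case of [trpow_product] where the eigenvalues of [X *m X^H] are at
    most 1; with [X] the identity it is Weyl's inequality between eigenvalues
    and singular values. *)
Lemma trpow_contraction n (X Y N D : 'M[C]_n) rho :
  0 <= rho -> psd (1%:M - X *m X^H) ->
  posdef N -> D \in unitmx -> X *m Y *m D = D *m N ->
  trpow N rho <= trpow (Y^H *m Y) (rho / 2).
Proof.
move=> rho0 cX pN uD h; have [uX uY] := product_unit pN uD h.
have [U [d [uU d0 sd eX]]] := posdef_spec (posdef_gram uX).
have [V [e [uV e0 se eY]]] := posdef_spec (posdef_gramV uY).
have h1 := trpow_product rho0 uU uV d0 e0 sd se eX eY pN uD h.
apply: le_trans h1 _; rewrite eY trpow_spec //; apply: ler_sum => j _.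
have dj := d0 j; have ej := e0 j.
apply: powR_le2; [by rewrite divr_ge0|by rewrite mulr_ge0 ?ltW|].
rewrite ger_pMl // -subr_ge0.
have h2 : psd (spec U (fun j => 1 - d j)) by rewrite -(sub1_spec d uU) -eX.
exact: (psd_spec_ge0 uU h2 j).
Qed.

End TraceInequalities.

(** * The Loewner order and the Riccati equation of the geometric mean *)

HB.lock Definition geom (R : realType) n (X Y : 'M[R[i]]_n) : 'M[R[i]]_n :=
  rpow X (1 / 2) *m
  rpow (rpow X (- (1 / 2)) *m Y *m rpow X (- (1 / 2))) (1 / 2) *m
  rpow X (1 / 2).

Section Order.
Variable R : realType.
Notation C := R[i].

Lemma half_add : 1 / 2 + 1 / 2 = 1 :> R. Proof. by field. Qed.

Lemma rpow_half n (A : 'M[C]_n) : posdef A -> rpow A (1 / 2) *m rpow A (1 / 2) = A.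
Proof. by move=> hA; rewrite rpowD // half_add rpow1. Qed.

Lemma rpow_nhalf n (A : 'M[C]_n) : posdef A ->
  rpow A (- (1 / 2)) *m rpow A (- (1 / 2)) = rpow A (-1).
Proof. by move=> hA; rewrite rpowD // -opprD half_add. Qed.

Lemma rpowNl n (A : 'M[C]_n) t : posdef A -> rpow A (- t) *m rpow A t = 1%:M.
Proof. by move=> hA; rewrite rpowD // addNr rpow0. Qed.

Lemma posdef_sandwich n (A S : 'M[C]_n) t : posdef A -> posdef S ->
  posdef (rpow A t *m S *m rpow A t).
Proof.
by move=> hA hS; rewrite -{1}(rpow_adj t hA); apply: posdef_congr; rewrite ?rpow_unit.
Qed.

Lemma psd_sandwich n (A S : 'M[C]_n) t : posdef A -> psd S ->
  psd (rpow A t *m S *m rpow A t).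
Proof. by move=> hA hS; rewrite -{1}(rpow_adj t hA); apply: psd_congr. Qed.

Lemma posdef_geom n (X Y : 'M[C]_n) : posdef X -> posdef Y -> posdef (geom X Y).
Proof.
move=> hX hY; rewrite geom.unlock; apply: posdef_sandwich => //.
by apply: posdef_rpow; apply: posdef_sandwich.
Qed.

(** This equation determines the geometric mean among positive definite
    matrices and replaces its definition from here on. *)
Lemma geom_riccati n (X Y : 'M[C]_n) : posdef X -> posdef Y ->
  geom X Y *m rpow X (-1) *m geom X Y = Y.
Proof.
move=> hX hY; rewrite geom.unlock.
have hM : posdef (rpow X (- (1 / 2)) *m Y *m rpow X (- (1 / 2))) by apply: posdef_sandwich.
have hM2 := rpow_half hM.
have e1 := rpowN (1 / 2) hX; have e2 := rpowNl (1 / 2) hX.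
rewrite -(rpow_nhalf hX).
move: (rpow (_ *m _ *m _) _) hM2 => M.
move: (rpow X (1 / 2)) (rpow X (- (1 / 2))) e1 e2 => h k e1 e2 hM2.
rewrite -!mulmxA (mulmxA h k) e1 mul1mx (mulmxA k h) e2 mul1mx (mulmxA M M) hM2.
by rewrite -!mulmxA e2 mulmx1 mulmxA e1 mul1mx.
Qed.

(** With [K = Y^(-1/2) X Y^(-1/2)], a contraction, [X] is similar to
    [K *m Y]. *)
Lemma trpow_le n (X Y : 'M[C]_n) c : 0 <= c -> posdef X -> posdef Y -> psd (Y - X) ->
  trpow X c <= trpow Y c.
Proof.
move=> c0 hX hY h.
have e1 := rpowN (1 / 2) hY; have e2 := rpowNl (1 / 2) hY.
have e3 := rpow_half hY.
pose K := rpow Y (- (1 / 2)) *m X *m rpow Y (- (1 / 2)).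
have hK : posdef K by apply: posdef_sandwich.
have cK : psd (1%:M - K).
  have := psd_sandwich (- (1 / 2)) hY h; congr psd.
  rewrite mulmxBr mulmxBl /K; congr (_ - _).
  by rewrite -{2}e3 mulmxA e2 mul1mx e1.
have cKK : psd (1%:M - K *m K^H).
  rewrite (posdef_adj hK) -(rpow2 hK).
  have [U [k [uU k0 _ eK]]] := posdef_spec hK; rewrite eK (rpow_spec _ _ uU).
  rewrite eK (sub1_spec k uU) in cK; have k1 := psd_spec_ge0 uU cK.
  rewrite (sub1_spec (fun j => k j `^ 2) uU); apply: psd_spec => j.
  have := k1 j; rewrite !subr_ge0 => kj1; have kj0 := k0 j.
  by rewrite (powR_mulrn 2 (ltW kj0)) expr_le1 // ltW.
have similar : K *m Y *m rpow Y (- (1 / 2)) = rpow Y (- (1 / 2)) *m X.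
  have Yk : Y *m rpow Y (- (1 / 2)) = rpow Y (1 / 2).
    by rewrite -{1}e3 -mulmxA e1 mulmx1.
  by rewrite -mulmxA Yk /K -!mulmxA e2 mulmx1.
have := trpow_contraction c0 cKK hX (rpow_unit _ hY) similar.
rewrite (posdef_adj hY) -(rpow2 hY) (trpow_rpow _ _ hY).
by have -> : 2 * (c / 2) = c by field.
Qed.

Lemma trpowZ n (Y : 'M[C]_n) (k c : R) : 0 < k -> posdef Y ->
  posdef (k%:C *: Y) /\ trpow (k%:C *: Y) c = k `^ c * trpow Y c.
Proof.
move=> k0 /posdef_spec[U [d [uU d0 _ ->]]]; rewrite specZ; split.
  by apply: spec_posdef => // j; rewrite mulr_gt0.
rewrite !(trpow_spec _ _ uU) mulr_sumr; apply: eq_bigr => j _.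
by rewrite powRM ?ltW.
Qed.

Lemma trpow_leZ n (X Y : 'M[C]_n) (k c : R) : 0 < k -> 0 <= c -> posdef X -> posdef Y ->
  psd (k%:C *: Y - X) -> trpow X c <= k `^ c * trpow Y c.
Proof.
move=> k0 c0 hX hY h; have [hkY <-] := trpowZ c k0 hY.
exact: trpow_le.
Qed.

Lemma quad_eigenvector n (s E : 'M[C]_n) (x : 'cV[C]_n) (a : R) :
  s^H = s -> s *m x = a%:C *: x ->
  x^H *m (s *m E *m s) *m x = (a ^+ 2)%:C *: (x^H *m E *m x).
Proof.
move=> as' sx; have xs : x^H *m s = a%:C *: x^H.
  rewrite -[s in LHS]as' -adjmxM sx.
  by rewrite adjmx.unlock linearZ /= map_mxZ /= conj_realC.
rewrite -!mulmxA sx !mulmxA xs -!scalemxAr -!scalemxAl scalerA.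
by rewrite -rmorphM -expr2.
Qed.

(** After the congruence by [T^(-1/2)] the hypothesis becomes
    [s *m E *m s <= E] with [s = T^(-1/2) S T^(-1/2)] and [E] positive definite.
    Tested on an eigenvector of [s] it says that the eigenvalue is at most 1.
    For [P] the identity this is the monotonicity of the square root. *)
Lemma loewner_of_sandwich n (S T P : 'M[C]_n) : posdef S -> posdef T -> posdef P ->
  psd (T *m P *m T - S *m P *m S) -> psd (T - S).
Proof.
move=> hS hT hP h.
have e1 := rpowN (1 / 2) hT; have e2 := rpowNl (1 / 2) hT.
have e3 := rpow_half hT.
pose s := rpow T (- (1 / 2)) *m S *m rpow T (- (1 / 2)).
pose E := rpow T (1 / 2) *m P *m rpow T (1 / 2).
have hE : posdef E by apply: posdef_sandwich.
have hs : posdef s by apply: posdef_sandwich.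
have hEs : psd (E - s *m E *m s).
  have := psd_sandwich (- (1 / 2)) hT h; congr psd.
  rewrite mulmxBr mulmxBl; congr (_ - _).
    have kT : rpow T (- (1 / 2)) *m T = rpow T (1 / 2).
      by rewrite -{2}e3 mulmxA e2 mul1mx.
    have Tk : T *m rpow T (- (1 / 2)) = rpow T (1 / 2).
      by rewrite -{1}e3 -mulmxA e1 mulmx1.
    by rewrite !mulmxA kT -mulmxA Tk.
  rewrite /s /E; move: (rpow T (1 / 2)) (rpow T (- (1 / 2))) e1 e2 => a b e1 e2.
  rewrite -!mulmxA; congr (_ *m (_ *m _)).
  by rewrite (mulmxA b a) e2 mul1mx (mulmxA a b) e1 mul1mx.
have [V [a [uV a0 _ es]]] := posdef_spec hs.
have a1 j : a j <= 1.
  pose x := V^H *m (delta_mx j 0 : 'cV[C]_n).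
  have sx : s *m x = (a j)%:C *: x.
    rewrite es spec.unlock /x -!mulmxA (mulmxA V) (unitaryK uV) mul1mx scalemxAr.
    congr (_ *m _); rewrite rdiag.unlock mul_diag_mx; apply/matrixP => i k.
    rewrite !mxE; have [->|_] := eqVneq i j; first by [].
    by rewrite !mulr0.
  have x0 : x != 0.
    apply: mulmx_unit_neq0; first by rewrite unitmx_adj unitarymx_unit.
    apply/eqP => /matrixP/(_ j 0); rewrite !mxE !eqxx => /eqP.
    by rewrite oner_eq0.
  have Ex := posdef_gt0 hE x0.
  have := psd_ge0 x hEs; rewrite mulmxBr mulmxBl.
  rewrite (quad_eigenvector E (posdef_adj hs) sx).
  move: (x^H *m E *m x) Ex => z z0.
  rewrite !mxE subr_ge0 -[X in _ <= X]mul1r ler_pM2r //.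
  rewrite -[1]/(1%:C) lecR => a2; rewrite -(@expr_le1 _ 2) // ltW //.
have h1 : psd (1%:M - s).
  by rewrite es (sub1_spec a uV); apply: psd_spec => j; rewrite subr_ge0.
have := psd_sandwich (1 / 2) hT h1; congr psd.
rewrite mulmxBr mulmxBl mulmx1 e3; congr (_ - _).
rewrite /s; move: (rpow T (1 / 2)) (rpow T (- (1 / 2))) e1 e2 => c b e1 e2.
by rewrite -!mulmxA e2 mulmx1 mulmxA e1 mul1mx.
Qed.

End Order.

(** * Squaring inside the geometric mean, and sums of geometric means *)

Section Sums.
Variable R : realType.
Notation C := R[i].

(** With [g] the square root of [G], [N = g^-1 X g^-1] and [E = g A' g], where
    [A'] stands for the inverse of [A], the two Riccati equations combine into
    [N E G^-1 E N = E G E]. *)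
Lemma riccati_square n (g gi G A' B X : 'M[C]_n) :
  g *m gi = 1%:M -> gi *m g = 1%:M -> g *m g = G ->
  G *m A' *m G = B -> X *m (A' *m A') *m X = B *m B ->
  gi *m X *m gi *m (g *m A' *m g) *m (gi *m gi) *m (g *m A' *m g) *m (gi *m X *m gi)
  = g *m A' *m g *m G *m (g *m A' *m g).
Proof.
move=> e1 e2 eG eB eX.
have c1 Z : Z *m g *m gi = Z by rewrite -mulmxA e1 mulmx1.
have c2 Z : Z *m gi *m g = Z by rewrite -mulmxA e2 mulmx1.
rewrite !mulmxA !c2 !c1.
have -> : gi *m X *m A' *m A' *m X *m gi = gi *m (X *m (A' *m A') *m X) *m gi.
  by rewrite !mulmxA.
rewrite eX -eB -eG.
transitivity (gi *m g *m g *m A' *m g *m g *m g *m g *m A' *m g *m g *m gi).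
  by rewrite !mulmxA.
by rewrite e2 mul1mx c1 !mulmxA.
Qed.

(** For [F] the inverse of [E], [F N E] is similar to [N] and factors as
    [(F N E g^-1) g]; the lemma says that the first factor times its adjoint
    is [G], that is, that it is [g] times a unitary matrix. *)
Lemma conj_riccati n (N E F gi G : 'M[C]_n) :
  F *m E = 1%:M -> E *m F = 1%:M ->
  N *m E *m (gi *m gi) *m E *m N = E *m G *m E ->
  (F *m N *m E *m gi) *m (gi *m (E *m (N *m F))) = G.
Proof.
move=> FE EF ric.
transitivity (F *m (N *m E *m (gi *m gi) *m E *m N) *m F).
  by rewrite !mulmxA.
by rewrite ric !mulmxA FE mul1mx -mulmxA EF mulmx1.
Qed.

(** The trace form of the Ando-Hiai inequality for the exponent 2.  With
    [G = A # B], [X = A^2 # B^2], [g = G^(1/2)] and [N = g^-1 X g^-1], the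
    matrix [N] is similar to [(g U) g] with [U] unitary, and [X] to [G N]; both
    similarities are fed to [trpow_holder] with equal exponents. *)
Lemma trpow_geom_square n (A B : 'M[C]_n) (r : R) : 0 < r -> posdef A -> posdef B ->
  trpow (geom (rpow A 2) (rpow B 2)) r <= trpow (geom A B) (2 * r).
Proof.
move=> r0 hA hB.
have hA2 := posdef_rpow 2 hA; have hB2 := posdef_rpow 2 hB.
have hG := posdef_geom hA hB; have hX := posdef_geom hA2 hB2.
have eB := geom_riccati hA hB.
have hA' := posdef_rpow (-1) hA.
have e22 : rpow (rpow A 2) (-1) = rpow A (-1) *m rpow A (-1).
  by rewrite rpowM // rpowD //; congr rpow; ring.
have eX : geom (rpow A 2) (rpow B 2) *m (rpow A (-1) *m rpow A (-1)) *m
    geom (rpow A 2) (rpow B 2) = B *m B.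
  by rewrite -e22 (geom_riccati hA2 hB2) rpow2.
move: (geom A B) (geom (rpow A 2) (rpow B 2)) (rpow A (-1)) hG hX eB eX hA' {e22}
  => G X A' hG hX eB eX hA'.
have e1 := rpowN (1 / 2) hG; have e2 := rpowNl (1 / 2) hG.
have e3 := rpow_half hG; have e4 := rpow_nhalf hG.
have ug := rpow_unit (1 / 2) hG.
have ag := rpow_adj (1 / 2) hG; have agi := rpow_adj (- (1 / 2)) hG.
have hN : posdef (rpow G (- (1 / 2)) *m X *m rpow G (- (1 / 2))) by apply: posdef_sandwich.
have hE : posdef (rpow G (1 / 2) *m A' *m rpow G (1 / 2)) by apply: posdef_sandwich.
have := riccati_square e1 e2 e3 eB eX.
move: (rpow G (1 / 2)) (rpow G (- (1 / 2))) e1 e2 e3 e4 ug ag agi hN hE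
  => g gi e1 e2 e3 e4 ug ag agi.
have similar : G *m (gi *m X *m gi) *m g = g *m X.
  have Ggi : G *m gi = g by rewrite -e3 -mulmxA e1 mulmx1.
  by rewrite !mulmxA Ggi -!mulmxA e2 mulmx1.
move: (gi *m X *m gi) (g *m A' *m g) similar => N E similar hN hE ric.
have uE := posdef_unit hE.
have h1 : trpow N (2 * r) <= trpow G (2 * r).
  have r20 : 0 < 2 * r by lra.
  have aE : (invmx E)^H = invmx E by rewrite (adjmx_inv uE) (posdef_adj hE).
  have FE := mulVmx uE; have EF := mulmxV uE.
  have uiE : invmx E \in unitmx by rewrite unitmx_inv.
  move: (invmx E) aE FE EF uiE => F aF FE EF uF.
  (* F N E = (F N E g^-1) g is the product to which the inequality applies. *)
  have sim : F *m N *m E *m gi *m g *m F = F *m N.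
    by rewrite -(mulmxA _ gi g) e2 mulmx1 -(mulmxA _ E F) EF mulmx1.
  have MG : (F *m N *m E *m gi) *m (F *m N *m E *m gi)^H = G.
    rewrite !adjmxM agi aF (posdef_adj hN) (posdef_adj hE).
    exact: conj_riccati FE EF ric.
  have := trpow_holder ltr01 ltr01 r20 hN uF sim.
  rewrite MG ag e3 !divr1.
  have -> : 2 * (2 * r) / (1 + 1) = 2 * r by field.
  have -> : 1 / (1 + 1) = 1 / 2 :> R by [].
  by lra.
have := trpow_holder ltr01 ltr01 r0 hX ug similar.
rewrite (posdef_adj hG) (posdef_adj hN) -(rpow2 hG) -(rpow2 hN) !divr1.
rewrite (trpow_rpow _ _ hG) (trpow_rpow _ _ hN).
have -> : 2 * r / (1 + 1) = r by field.
have -> : 1 / (1 + 1) = 1 / 2 :> R by [].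
by lra.
Qed.

Lemma psd_diag n (A : 'M[C]_n) j : psd A -> 0 <= A j j.
Proof.
move=> hA; have := psd_ge0 (delta_mx j 0) hA.
have -> : (delta_mx j 0 : 'cV[C]_n)^H = delta_mx 0 j.
  by rewrite adjmx.unlock trmx_delta; apply/matrixP => a b; rewrite !mxE conjC_nat.
by rewrite -rowE -colE !mxE.
Qed.

Lemma psd_trace n (A : 'M[C]_n) : psd A -> 0 <= \tr A.
Proof. by move=> hA; apply: sumr_ge0 => j _; apply: psd_diag. Qed.

Lemma psd0 n : psd (0 : 'M[C]_n).
Proof. by apply: psdI => x; rewrite mulmx0 mul0mx mxE. Qed.

Lemma psd_sum n m (A : 'I_m -> 'M[C]_n) : (forall i, psd (A i)) ->
  psd (\sum_i A i).
Proof.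
move=> hA; elim/big_ind : _ => [|X Y|i _]; [exact: psd0|exact: psdD|exact: hA].
Qed.

Lemma mxtrace_specM n (V : 'M[C]_n) x (Y : 'M[C]_n) :
  \tr (spec V x *m Y) = \sum_j (x j)%:C * (V *m Y *m V^H) j j.
Proof.
rewrite spec.unlock -!mulmxA mxtrace_mulC -!mulmxA.
move: (V *m (Y *m V^H)) => Z.
by apply: eq_bigr => j _; rewrite rdiag.unlock mul_diag_mx !mxE.
Qed.

(** In an eigenbasis of [X], with eigenvalues [x j], the claim is
    [x j `^ (u - 1) <= (T^(u-1)) j j].  The diagonal entries of a function of
    [T] are means of that function over the spectrum of [T], so this is
    Jensen's inequality applied to [x j <= T j j]. *)
Lemma trpow_le_mxtrace n (X T : 'M[C]_n) (u : R) :
  2 <= u -> posdef X -> posdef T -> psd (T - X) ->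
  (trpow X u)%:C <= \tr (X *m rpow T (u - 1)).
Proof.
move=> u2 /posdef_spec[V [x [uV x0 _ ->]]] /posdef_spec[W [t [uW t0 _ ->]]] h.
rewrite (trpow_spec _ _ uV) (rpow_spec _ _ uW) mxtrace_specM rmorph_sum /=.
pose O := W *m V^H.
have uO : O^H \is unitarymx.
  apply: unitaryE; rewrite /O adjmxK adjmxM adjmxK.
  by rewrite -mulmxA (mulmxA W^H) (unitaryKV uW) mul1mx unitaryK.
pose w j k : R := complex.Re (`|O k j| ^+ 2).
have wE j k : (w j k)%:C = `|O k j| ^+ 2.
  by rewrite /w RRe_real // realX // normr_real.
have w0 j k : 0 <= w j k by rewrite -lecR wE exprn_ge0.
have w1 j : \sum_k w j k = 1.
  apply: (@complexI R); rewrite rmorph_sum /=; apply: etrans (unitary_row_norm j uO).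
  by apply: eq_bigr => k _; rewrite wE adjmxE norm_conjC.
have quad j (s : 'I_n -> R) : (V *m spec W s *m V^H) j j = (\sum_k w j k * s k)%:C.
  have := spec_quad W s V^H j; rewrite adjmxK => ->.
  by rewrite rmorph_sum /=; apply: eq_bigr => k _; rewrite rmorphM /= wE mulrC.
have below j : x j <= \sum_k w j k * t k.
  have := psd_diag j (psd_congr V^H h).
  have -> : V^H^H *m (spec W t - spec V x) *m V^H = V *m spec W t *m V^H - rdiag x.
    rewrite adjmxK mulmxBr mulmxBl; congr (_ - _).
    by rewrite spec.unlock !mulmxA (unitaryK uV) mul1mx -mulmxA (unitaryK uV) mulmx1.
  move: (quad j t); move: (V *m spec W t *m V^H) => Z qj.
  rewrite rdiag.unlock !mxE qj eqxx mulr1n subr_ge0.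
  by rewrite lecR.
apply: ler_sum => j _; rewrite quad -rmorphM /= lecR.
have u1 : 1 <= u - 1 by lra.
have xj := x0 j.
have -> : x j `^ u = x j * x j `^ (u - 1) by rewrite mulr_powRB1 ?ltW //; lra.
rewrite ler_pM2l //.
apply: le_trans (jensen_powR u1 (w0 j) (w1 j) t0).
by apply: powR_le2 (below j); [lra|exact: ltW].
Qed.

(** Since [X i <= T], each summand is at most [\tr (X i *m T^(u-1))]; the sum
    of these is at most [\tr (T *m T^(u-1))]. *)
Lemma sum_trpow_le n m (X : 'I_m -> 'M[C]_n) (T : 'M[C]_n) (u : R) : 2 <= u ->
  (forall i, posdef (X i)) -> posdef T -> psd (T - \sum_i X i) ->
  \sum_i trpow (X i) u <= trpow T u.
Proof.
move=> u2 hX hT h.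
have below i : psd (T - X i).
  have : psd (\sum_(j | j != i) X j).
    by elim/big_ind : _ => [|Y Z|j _]; [exact: psd0|exact: psdD|exact: posdef_psd].
  move=> /(psdD h); congr psd; rewrite (bigD1 i) //= opprD addrA subrK.
  by [].
rewrite -lecR rmorph_sum /=.
apply: (@le_trans _ _ (\tr ((\sum_i X i) *m rpow T (u - 1)))).
  rewrite mulmx_suml raddf_sum /=; apply: ler_sum => i _.
  exact: trpow_le_mxtrace.
have := psd_trace (psd_sandwich ((u - 1) / 2) hT h).
rewrite mxtrace_mulC mulmxA rpowD //.
have -> : (u - 1) / 2 + (u - 1) / 2 = u - 1 by field.
rewrite mxtrace_mulC mulmxBl raddfB /= subr_ge0 => h2; apply: le_trans h2 _.
by rewrite -{1}(rpow1 hT) rpowD // addrC subrK trpowE.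
Qed.

(** Let [S] be the sum of the [G i = geom (A i) (B i)] and [P] the inverse of
    the sum of the [A i].  By [loewner_of_sandwich] and the Riccati equations
    it suffices that [S P S] is at most the sum of the
    [B i = G i (A i)^-1 G i].  The difference is the sum of the positive
    semidefinite matrices [(Z i)^H (A i) (Z i)] with
    [Z i = (A i)^-1 G i - P S]. *)
Lemma geom_sum_le n m (A B : 'I_m -> 'M[C]_n) : (0 < m)%N ->
  (forall i, posdef (A i)) -> (forall i, posdef (B i)) ->
  psd (geom (\sum_i A i) (\sum_i B i) - \sum_i geom (A i) (B i)).
Proof.
move=> m0 hA hB.
have hsA := posdef_sum m0 hA; have hsB := posdef_sum m0 hB.
have hG i := posdef_geom (hA i) (hB i).
have hS := posdef_sum m0 hG.
apply: (loewner_of_sandwich hS (posdef_geom hsA hsB) (posdef_rpow (-1) hsA)).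
rewrite (geom_riccati hsA hsB).
have ric i := geom_riccati (hA i) (hB i).
have aP := rpow_adj (-1) hsA.
have PA : rpow (\sum_i A i) (-1) *m (\sum_i A i) = 1%:M.
  by rewrite -{2}(rpow1 hsA) rpowNl.
have PAi i : rpow (A i) (-1) *m A i = 1%:M by rewrite -{2}(rpow1 (hA i)) rpowNl.
have APi i : A i *m rpow (A i) (-1) = 1%:M by rewrite -{1}(rpow1 (hA i)) rpowN.
have aG i := posdef_adj (hG i); have aS := posdef_adj hS.
have aPi i := rpow_adj (-1) (hA i).
move: (rpow (\sum_i A i) (-1)) aP PA => P aP PA.
set S := \sum_i geom (A i) (B i) in aS *.
pose Z i := rpow (A i) (-1) *m geom (A i) (B i) - P *m S.
have : psd (\sum_i (Z i)^H *m A i *m Z i).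
  by apply: psd_sum => i; apply: psd_congr; apply: posdef_psd.
congr psd.
have ZE i : (Z i)^H *m A i *m Z i =
    B i - geom (A i) (B i) *m (P *m S) - S *m P *m geom (A i) (B i)
    + S *m P *m A i *m (P *m S).
  rewrite /Z adjmxB !adjmxM aG aPi aP aS.
  move: (geom (A i) (B i)) (rpow (A i) (-1)) (ric i) (PAi i) (APi i) => G Q r1 r2 r3.
  rewrite mulmxBl -(mulmxA G) r2 mulmx1 mulmxBr !mulmxBl (mulmxA G Q G) r1.
  rewrite -(mulmxA (S *m P) (A i) (Q *m G)) (mulmxA (A i) Q G) r3 mul1mx.
  have zm (a b c d : 'M[C]_n) : a - b - (c - d) = a - c - b + d.
    by rewrite opprB addrA addrAC [a - b - c]addrAC.
  exact: zm.
under eq_bigr do rewrite ZE.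
rewrite big_split /= !sumrB -!mulmx_suml -!mulmx_sumr -/S.
by rewrite -(mulmxA S P (\sum_i A i)) PA mulmx1 mulmxA subrK.
Qed.

End Sums.

(** * The Araki-Lieb-Thirring inequality *)

Section Araki.
Variable R : realType.
Notation C := R[i].

Lemma trpow_geom_halving n (A B : 'M[C]_n) (u : R) k : 0 < u -> posdef A -> posdef B ->
  trpow (geom A B) u <=
  trpow (geom (rpow A (2 ^- k)) (rpow B (2 ^- k))) (2 ^+ k * u).
Proof.
move=> u0 hA hB; elim: k => [|k IH].
  by rewrite expr0 invr1 mul1r !rpow1.
apply: le_trans IH _.
have u1 : 0 < 2 ^+ k * u by rewrite mulr_gt0 ?exprn_gt0.
have := trpow_geom_square u1 (posdef_rpow (2 ^- k.+1) hA) (posdef_rpow (2 ^- k.+1) hB).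
rewrite !rpowM // exprS mulrA.
have -> : (2 * 2 ^+ k)^-1 * 2 = 2 ^- k :> R by rewrite invfM mulrAC mulVf ?mul1r ?pnatr_eq0.
by [].
Qed.

Lemma psd_sub11 n : psd (1%:M - (1%:M : 'M[C]_n) *m (1%:M)^H).
Proof. by rewrite adjmx1 mulmx1 subrr; apply: psd0. Qed.

Lemma trpow_weyl n (Y N D : 'M[C]_n) rho : 0 <= rho ->
  posdef N -> D \in unitmx -> Y *m D = D *m N ->
  trpow N rho <= trpow (Y^H *m Y) (rho / 2).
Proof.
move=> r0 hN uD h; apply: (trpow_contraction r0 (psd_sub11 n) hN uD).
by rewrite mul1mx.
Qed.

(** With [Z = P # Q] and [Y = P^(-1/2) Z P^(1/2)], which is similar to [Z], the
    Riccati equation says that [Y^H Y = P^(1/2) Q P^(1/2)]. *)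
Lemma trpow_geom_le_sandwich n (P Q : 'M[C]_n) v : 0 <= v -> posdef P -> posdef Q ->
  trpow (geom P Q) (2 * v) <= trpow (rpow P (1 / 2) *m Q *m rpow P (1 / 2)) v.
Proof.
move=> v0 hP hQ; have hZ := posdef_geom hP hQ; have eZ := geom_riccati hP hQ.
have uD := rpow_unit (- (1 / 2)) hP.
move: (geom P Q) hZ eZ => Z hZ eZ; rewrite -eZ -(rpow_nhalf hP) {eZ}.
have e1 := rpowN (1 / 2) hP.
have aP := rpow_adj (1 / 2) hP; have aPi := rpow_adj (- (1 / 2)) hP.
move: (rpow P (1 / 2)) (rpow P (- (1 / 2))) uD e1 aP aPi => h k uD e1 aP aPi.
have v20 : 0 <= 2 * v by lra.
have sim : k *m Z *m h *m k = k *m Z by rewrite -mulmxA e1 mulmx1.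
have eY : (k *m Z *m h)^H *m (k *m Z *m h) = h *m (Z *m (k *m k) *m Z) *m h.
  by rewrite !adjmxM aP aPi (posdef_adj hZ) !mulmxA.
have := trpow_weyl v20 hZ uD sim; rewrite eY.
have -> : 2 * v / 2 = v by field.
by [].
Qed.

(** The function phi of the introduction; its limit at 0 is
    tr exp (r (log A + log B)). *)
Definition araki n (A B : 'M[C]_n) (r t : R) :=
  trpow (rpow A (t / 2) *m rpow B t *m rpow A (t / 2)) (r / t).

Lemma half_split (t : R) : t / 2 + t / 2 = t. Proof. by field. Qed.

Lemma posdef_araki n (A B : 'M[C]_n) s t : posdef A -> posdef B ->
  posdef (rpow A s *m rpow B t *m rpow A s).
Proof. by move=> hA hB; apply: posdef_sandwich => //; apply: posdef_rpow. Qed.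

Lemma sandwich_gram n (A B : 'M[C]_n) s t : posdef A -> posdef B ->
  rpow A s *m rpow B t *m rpow A s =
  rpow A s *m rpow B (t / 2) *m (rpow A s *m rpow B (t / 2))^H.
Proof.
move=> hA hB; rewrite adjmxM !rpow_adj // -!mulmxA (mulmxA (rpow B _)) rpowD //.
by rewrite half_split.
Qed.

Lemma sandwich_gramV n (A B : 'M[C]_n) s t : posdef A -> posdef B ->
  rpow A s *m rpow B t *m rpow A s =
  (rpow B (t / 2) *m rpow A s)^H *m (rpow B (t / 2) *m rpow A s).
Proof. by move=> hA hB; rewrite sandwich_gram // !adjmxM !rpow_adj. Qed.

(** For [t] the midpoint, [A^(t/2) B^t A^(t/2)] is similar to the product of
    [A^(t2/2) B^(t2/2)] and [B^(t1/2) A^(t1/2)], whose Gram matrices are the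
    ones that define [araki] at [t2] and at [t1]. *)
Lemma araki_midpoint n (A B : 'M[C]_n) (t1 t2 r : R) : posdef A -> posdef B ->
  0 < t1 -> 0 < t2 -> 0 < r ->
  araki A B r ((t1 + t2) / 2) <= t2 / (t1 + t2) * araki A B r t2
                             + t1 / (t1 + t2) * araki A B r t1.
Proof.
move=> hA hB t10 t20 r0; rewrite /araki.
set t := (t1 + t2) / 2.
have sim : rpow A (t2 / 2) *m rpow B (t2 / 2) *m (rpow B (t1 / 2) *m rpow A (t1 / 2))
     *m rpow A (t2 / 2 - t / 2)
   = rpow A (t2 / 2 - t / 2) *m (rpow A (t / 2) *m rpow B t *m rpow A (t / 2)).
  rewrite -!mulmxA (rpowD (t1 / 2) _ hA) (mulmxA (rpow B _)) (rpowD _ _ hB).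
  rewrite !mulmxA (rpowD _ (t / 2) hA) subrK.
  by congr (_ *m rpow _ _ *m rpow _ _); rewrite /t; field.
have := trpow_holder t20 t10 r0 (posdef_araki _ _ hA hB) (rpow_unit _ hA) sim.
rewrite -sandwich_gram // -sandwich_gramV // [t2 + t1]addrC.
have -> : 2 * r / (t1 + t2) = r / t by rewrite /t; field; rewrite gt_eqF //; lra.
by [].
Qed.

(** The midpoint inequality with one of the exponents equal to 0, where
    [araki] is not defined: [A^(t/4) B^(t/2) A^(t/4)] is similar to
    [B^(t/2) A^(t/2)]. *)
Lemma araki_half n (A B : 'M[C]_n) (t r : R) : posdef A -> posdef B -> 0 < t -> 0 < r ->
  araki A B r (t / 2) <= araki A B r t.
Proof.
move=> hA hB t0 r0; rewrite /araki.
have sim : rpow B (t / 2) *m rpow A (t / 2) *m rpow A (- (t / 2 / 2)) =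
    rpow A (- (t / 2 / 2)) *m
      (rpow A (t / 2 / 2) *m rpow B (t / 2) *m rpow A (t / 2 / 2)).
  rewrite -!mulmxA (rpowD (t / 2) _ hA) (mulmxA (rpow A (- _))) rpowNl // mul1mx.
  by congr (_ *m rpow _ _); field.
have r1 : 0 <= r / (t / 2) by rewrite !divr_ge0 // ltW.
have := trpow_weyl r1 (posdef_araki _ _ hA hB) (rpow_unit _ hA) sim.
rewrite -sandwich_gramV //.
have -> : r / (t / 2) / 2 = r / t by field; rewrite gt_eqF.
by [].
Qed.

Lemma araki_dyadic n (A B : 'M[C]_n) (r q : R) k j : posdef A -> posdef B -> 0 < r ->
  0 < q -> (0 < j <= 2 ^ k)%N ->
  araki A B r (j%:R / 2 ^+ k * q) <= araki A B r q.
Proof.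
move=> hA hB r0 q0; elim: k j => [|k IH] j /andP[j0 jk].
  have -> : j = 1%N by rewrite expn0 in jk; lia.
  by rewrite expr0 divr1 mul1r.
have pos i : (0 < i)%N -> 0 < i%:R / 2 ^+ k * q :> R.
  by move=> i0; rewrite mulr_gt0 // divr_gt0 ?exprn_gt0 ?ltr0n.
have e2 := expnS 2 k.
have step x : x / 2 ^+ k.+1 * q = (x / 2 ^+ k * q) / 2 :> R.
  by rewrite exprS invfM; move: (2 ^+ k)^-1 => z; ring.
rewrite step.
have [oj|ej] := boolP (odd j); last first.
  have jE : j = (j./2 * 2)%N by rewrite muln2 even_halfK.
  have -> : j%:R / 2 ^+ k * q / 2 = j./2%:R / 2 ^+ k * q.
    by rewrite {1}jE natrM; move: (2 ^+ k)^-1 => z; field.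
  by apply: IH; lia.
(* An odd j makes j / 2^(k+1) the midpoint of j./2 / 2^k and (j./2 + 1) / 2^k;
   for j = 1 the former is 0. *)
have jE : j = (j./2 + j./2.+1)%N by rewrite -[LHS]odd_double_half oj; lia.
have [j1|jn1] := eqVneq j 1%N.
  apply: le_trans (araki_half hA hB _ r0) _; first by rewrite j1; apply: pos.
  by rewrite j1; apply: IH; rewrite expn_gt0.
have i0 : (0 < j./2)%N by lia.
have h1 : (0 < j./2 <= 2 ^ k)%N by lia.
have h2 : (0 < j./2.+1 <= 2 ^ k)%N by lia.
have p1 := pos _ i0; have p2 := pos _ (ltn0Sn j./2).
rewrite {1}jE natrD !mulrDl -mulrDl.
apply: le_trans (araki_midpoint hA hB p1 p2 r0) _.
have q1 := IH _ h1; have q2 := IH _ h2.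
move: (j./2%:R / 2 ^+ k * q) (j./2.+1%:R / 2 ^+ k * q) p1 p2 q1 q2
  => t1 t2 p1 p2 q1 q2.
have t0 : 0 < t1 + t2 by rewrite addr_gt0.
have w1 : 0 <= t1 / (t1 + t2) by rewrite divr_ge0 // ltW.
have w2 : 0 <= t2 / (t1 + t2) by rewrite divr_ge0 // ltW.
apply: le_trans (lerD (ler_wpM2l w2 q2) (ler_wpM2l w1 q1)) _.
by rewrite -mulrDl -[t2 / _ + _]mulrDl [t2 + t1]addrC divff ?mul1r // gt_eqF.
Qed.

(** [m] is any positive lower bound of the spectrum of [A]. *)
Lemma rpow_lower_exponent n (A : 'M[C]_n) : posdef A ->
  exists2 m : R, 0 < m & forall q q', q' <= q ->
    psd ((m `^ (q' - q))%:C *: rpow A q - rpow A q').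
Proof.
move=> /posdef_spec[U [d [uU d0 _ ->]]].
pose m := \big[Num.min/1]_j d j.
have m0 : 0 < m by rewrite /m; elim/big_ind : _ => // x y x0 y0; rewrite lt_min x0.
have md j : m <= d j by rewrite /m; apply: bigmin_le_cond.
exists m => // q q' qq; rewrite !rpow_spec // specZ.
have -> : spec U (fun j => m `^ (q' - q) * d j `^ q) - spec U (fun j => d j `^ q') =
  spec U (fun j => m `^ (q' - q) * d j `^ q - d j `^ q').
  rewrite spec.unlock -mulmxBl -mulmxBr; congr (_ *m _ *m _).
  rewrite rdiag.unlock -raddfB; congr diag_mx.
  by apply/rowP => j; rewrite !mxE -rmorphB.
apply: psd_spec => j; rewrite subr_ge0.
have -> : d j `^ q' = d j `^ (q' - q) * d j `^ q.
  by rewrite -powRD ?subrK // (gt_eqF (d0 j)) implybT.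
rewrite ler_wpM2r ?powR_ge0 // -[q' - q]opprB !powRN lef_pV2 ?posrE ?powR_gt0 //.
by apply: powR_le2 (md j); [lra|exact: ltW].
Qed.

Lemma trpow_exponent n (A : 'M[C]_n) : posdef A ->
  exists2 L : R, 0 < L & forall c c', c <= c' -> trpow A c' <= L `^ (c' - c) * trpow A c.
Proof.
move=> /posdef_spec[U [d [uU d0 _ ->]]].
pose L := \big[Num.max/1]_j d j.
have Ld j : d j <= L by rewrite /L; apply: le_bigmax_cond.
have L0 : 0 < L by rewrite /L; elim/big_ind : _ => // x y x0 y0; rewrite lt_max x0.
exists L => // c c' cc; rewrite !trpow_spec // mulr_sumr; apply: ler_sum => j _.
have -> : d j `^ c' = d j `^ (c' - c) * d j `^ c.
  by rewrite -powRD ?subrK // (gt_eqF (d0 j)) implybT.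
rewrite ler_wpM2r ?powR_ge0 //.
by apply: powR_le2 (Ld j); [lra|exact: ltW].
Qed.

Lemma trpow_swap n (A B : 'M[C]_n) (s t c : R) : posdef A -> posdef B ->
  trpow (rpow A (s / 2) *m rpow B t *m rpow A (s / 2)) c =
  trpow (rpow B (t / 2) *m rpow A s *m rpow B (t / 2)) c.
Proof.
move=> hA hB; apply: (@trpow_similar _ _ _ _ (rpow A (s / 2) *m rpow B (t / 2))).
- by apply: posdef_sandwich => //; apply: posdef_rpow.
- by apply: posdef_sandwich => //; apply: posdef_rpow.
- by rewrite unitmx_mul !rpow_unit.
rewrite -!mulmxA; congr (_ *m _).
rewrite !mulmxA (rpowD _ _ hB) half_split.
by rewrite -(mulmxA (rpow B t)) (rpowD _ _ hA) half_split.
Qed.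

(** Lowering the exponents of [A] and [B] from [q] to [q'] multiplies the matrix
    by at most a scalar that tends to 1, in the Loewner order; [trpow_swap]
    exposes each of the two powers in turn.  Then the outer exponent is
    lowered.  Every scalar that arises is a power with the exponent
    [r / q' - r / q] of a number that does not depend on [q']. *)
Lemma araki_semicontinuous n (A B : 'M[C]_n) (r q : R) : posdef A -> posdef B -> 0 < r ->
  0 < q -> exists2 Om : R, 0 < Om & forall q', 0 < q' <= q ->
    araki A B r q' <= Om `^ (r / q' - r / q) * araki A B r q.
Proof.
move=> hA hB r0 q0.
have [mA mA0 hmA] := rpow_lower_exponent hA.
have [mB mB0 hmB] := rpow_lower_exponent hB.
have hM s t : posdef (rpow A s *m rpow B t *m rpow A s).
  by apply: posdef_sandwich => //; apply: posdef_rpow.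
have hM' s t : posdef (rpow B s *m rpow A t *m rpow B s).
  by apply: posdef_sandwich => //; apply: posdef_rpow.
have [L L0 hL] := trpow_exponent (hM (q / 2) q).
exists (mB `^ (- q) * (mA `^ (- q) * L)); first by rewrite !mulr_gt0 ?powR_gt0.
move=> q' /andP[q'0 q'q]; rewrite /araki.
have c0 : 0 <= r / q' by rewrite divr_ge0 // ltW.
have cc : r / q <= r / q' by rewrite ler_pM2l // lef_pV2 ?posrE.
(* (q' - q) (r / q') = - q (r / q' - r / q) *)
have expo m : (m `^ (q' - q)) `^ (r / q') = (m `^ (- q)) `^ (r / q' - r / q).
  by rewrite -!powRrM; congr (_ `^ _); field; rewrite !gt_eqF.
have pB : 0 < mB `^ (q' - q) by rewrite powR_gt0.
have pA : 0 < mA `^ (q' - q) by rewrite powR_gt0.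
have h1 : psd ((mB `^ (q' - q))%:C *: (rpow A (q' / 2) *m rpow B q *m rpow A (q' / 2))
   - rpow A (q' / 2) *m rpow B q' *m rpow A (q' / 2)).
  have := psd_sandwich (q' / 2) hA (hmB q q' q'q); congr psd.
  by rewrite mulmxBr mulmxBl -scalemxAr -scalemxAl.
have h2 : psd ((mA `^ (q' - q))%:C *: (rpow B (q / 2) *m rpow A q *m rpow B (q / 2))
   - rpow B (q / 2) *m rpow A q' *m rpow B (q / 2)).
  have := psd_sandwich (q / 2) hB (hmA q q' q'q); congr psd.
  by rewrite mulmxBr mulmxBl -scalemxAr -scalemxAl.
have := trpow_leZ pB c0 (hM _ _) (hM _ _) h1; rewrite expo => h3.
apply: le_trans h3 _.
rewrite (powRM _ (powR_ge0 _ _) (mulr_ge0 (powR_ge0 _ _) (ltW L0))).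
rewrite -mulrA ler_wpM2l ?powR_ge0 // (trpow_swap q' q _ hA hB).
have := trpow_leZ pA c0 (hM' _ _) (hM' _ _) h2; rewrite expo => h4.
apply: le_trans h4 _.
rewrite (powRM _ (powR_ge0 _ _) (ltW L0)) -mulrA ler_wpM2l ?powR_ge0 //.
by rewrite -(trpow_swap q q _ hA hB) hL.
Qed.

(** A limit argument without limits: [Om `^ - eta] is at least
    [1 - eta * `|ln Om|]. *)
Lemma le_of_small_powers (L f Om : R) : 0 <= f -> 0 < Om ->
  (forall eps, 0 < eps -> exists2 eta, 0 <= eta <= eps & L <= Om `^ eta * f) ->
  L <= f.
Proof.
move=> f0 Om0 h; rewrite leNgt; apply/negP => fL.
pose K := `|ln Om|; have K0 : 0 <= K by apply: normr_ge0.
have D0 : 0 < L * K + 1 by rewrite ltr_wpDl // mulr_ge0 // ltW //; lra.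
(* An eta below this bound gives eta L K < L - f unless eta = 0, which
   contradicts L (1 - eta K) <= f. *)
have e0 : 0 < (L - f) / (L * K + 1) by rewrite divr_gt0 // subr_gt0.
have [eta /andP[eta0 etae]] := h _ e0.
have : 1 - eta * K <= Om `^ (- eta).
  have := expR_ge1Dx (- eta * ln Om); rewrite /powR gt_eqF //.
  by have := ler_norm (ln Om); rewrite -/K; nra.
rewrite powRN => h1 h2.
have p0 : 0 < Om `^ eta by rewrite powR_gt0.
have h3 : L * (1 - eta * K) <= f.
  have L0 : 0 <= L by lra.
  apply: le_trans (ler_wpM2l L0 h1) _.
  by rewrite ler_pdivrMr // mulrC.
have h4 : eta * (L * K + 1) <= L - f by rewrite -ler_pdivlMr.
have h5 : eta = 0 by nra.
by rewrite h5 in h3; lra.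
Qed.

Lemma small_dyadic (eps : R) : 0 < eps -> exists k, 2 ^- k < eps.
Proof.
move=> e0; exists (Num.truncn eps^-1).+1.
rewrite invf_plt ?posrE ?exprn_gt0 //.
apply: lt_le_trans (truncnS_gt _) _.
by rewrite -natrX ler_nat ltnW // ltn_expl.
Qed.

Lemma dyadic_above (t0 : R) k : 0 <= t0 <= 1 ->
  exists2 j, (0 < j <= 2 ^ k)%N & t0 <= j%:R / 2 ^+ k <= t0 + 2 ^- k.
Proof.
move=> /andP[t00 t01]; have p0 : 0 < 2 ^+ k :> R by rewrite exprn_gt0.
have x0 : 0 <= t0 * 2 ^+ k by rewrite mulr_ge0 // ltW.
have x1 : t0 * 2 ^+ k <= (2 ^ k)%:R by rewrite natrX ger_pMl.
have /andP[g1 g2] := truncn_itv x0.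
(* The cap at 2 ^ k matters only for t0 close to 1. *)
exists (minn (Num.truncn (t0 * 2 ^+ k)).+1 (2 ^ k)).
  by rewrite leq_min geq_minr expn_gt0.
rewrite ler_pdivlMr // ler_pdivrMr // mulrDl mulVf ?gt_eqF //.
apply/andP; split; first by rewrite natr_min le_min x1 (ltW g2).
apply: (@le_trans _ _ (Num.truncn (t0 * 2 ^+ k)).+1%:R).
  by rewrite ler_nat geq_minl.
by rewrite -addn1 natrD lerD2r.
Qed.

(** [dl / t] tends to [q] from below as the dyadic [t] decreases to [dl / q]; for
    such [t], [araki_dyadic] compares [dl] with [dl / t] and
    [araki_semicontinuous] compares [dl / t] with [q]. *)
Lemma araki_mono n (A B : 'M[C]_n) (r dl q : R) : posdef A -> posdef B -> 0 < r ->
  0 < dl -> dl <= q -> araki A B r dl <= araki A B r q.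
Proof.
move=> hA hB r0 dl0 dq; have q0 : 0 < q by lra.
have [Om Om0 hOm] := araki_semicontinuous hA hB r0 q0.
apply: (@le_of_small_powers _ _ Om) => // [|eps e0].
  by apply: trpow_ge0; apply: posdef_araki.
(* r / (dl / t) - r / q = (r / dl) (t - dl / q), so t must approximate dl / q
   from above within eps dl / r. *)
have [k hk] : exists k, 2 ^- k < eps * dl / r.
  by apply: small_dyadic; rewrite !mulr_gt0 ?invr_gt0.
pose t0 := dl / q; have t00 : 0 < t0 by rewrite divr_gt0.
have t01 : t0 <= 1 by rewrite ler_pdivrMr // mul1r.
have p0 : 0 < 2 ^+ k :> R by rewrite exprn_gt0.
have ht0 : 0 <= t0 <= 1 by rewrite (ltW t00).
have [j hj ht] := dyadic_above k ht0.
pose t : R := j%:R / 2 ^+ k; rewrite -/t in ht.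
have /andP[ht1 ht2] := ht; have tgt0 : 0 < t by lra.
have q'0 : 0 < dl / t by rewrite divr_gt0.
have q'q : dl / t <= q by rewrite ler_pdivrMr // mulrC -ler_pdivrMr.
exists (r / (dl / t) - r / q).
  have -> : r / (dl / t) - r / q = r / dl * (t - t0).
    by rewrite /t0; field; rewrite !gt_eqF.
  have rd0 : 0 < r / dl by rewrite divr_gt0.
  have htt : 0 <= t - t0 by rewrite subr_ge0.
  rewrite (mulr_ge0 (ltW rd0) htt) /=.
  have -> : eps = r / dl * (eps * dl / r) by field; rewrite !gt_eqF.
  by rewrite ler_wpM2l ?(ltW rd0) //; lra.
have hq : 0 < dl / t <= q by rewrite q'0.
apply: le_trans (hOm _ hq).
have := araki_dyadic hA hB r0 q'0 hj.
by have -> : j%:R / 2 ^+ k * (dl / t) = dl by rewrite -/t mulrC divfK // gt_eqF.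
Qed.

Lemma trpow_geom_le_araki n (A B : 'M[C]_n) (r q : R) :
  posdef A -> posdef B -> 0 < r -> 0 < q ->
  trpow (geom A B) (2 * r) <= araki A B r q.
Proof.
move=> hA hB r0 q0; have [k hk] := small_dyadic q0.
have d0 : 0 < 2 ^- k :> R by rewrite invr_gt0 exprn_gt0.
have r20 : 0 < 2 * r by lra.
apply: le_trans (araki_mono hA hB r0 d0 (ltW hk)).
apply: le_trans (trpow_geom_halving k r20 hA hB) _.
have v0 : 0 <= 2 ^+ k * r by rewrite mulr_ge0 ?exprn_ge0 // ltW.
have := trpow_geom_le_sandwich v0 (posdef_rpow (2 ^- k) hA) (posdef_rpow (2 ^- k) hB).
rewrite /araki !rpowM // mul1r invrK mulrCA [r * _]mulrC.
by [].
Qed.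

End Araki.

Theorem theorem4p1 (R : realType) (m n : nat) (A B : 'I_m -> 'M[R[i]]_n)
    (p r : R) (hm : (1 <= m)%N)
    (hA : forall i : 'I_m, posdefmx (A i))
    (hB : forall i : 'I_m, posdefmx (B i))
    (hp : 0 < p) (hr : 1 <= r) :
  tracenorm (\sum_(i < m) mxpowR (geomean (A i ^+ 2) (B i ^+ 2)) r)
  <= tracenorm
       (mxpowR
          (mxpowR (\sum_(i < m) A i) (p * r / 2)
           *m mxpowR (\sum_(i < m) B i) (p * r)
           *m mxpowR (\sum_(i < m) A i) (r * p / 2))
          (1 / p)).
Proof.
have {}hA i : posdef (A i) by apply/posdefmxP.
have {}hB i : posdef (B i) by apply/posdefmxP.
have r0 : 0 < r by lra.
have q0 : 0 < p * r by rewrite mulr_gt0.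
have hsA := posdef_sum hm hA; have hsB := posdef_sum hm hB.
have hA2 i := posdef_rpow 2 (hA i); have hB2 i := posdef_rpow 2 (hB i).
have hX i := posdef_geom (hA2 i) (hB2 i).
have eL : \sum_(i < m) mxpowR (geomean (A i ^+ 2) (B i ^+ 2)) r =
    \sum_(i < m) rpow (geom (rpow (A i) 2) (rpow (B i) 2)) r.
  apply: eq_bigr => i _; rewrite rpow2 // rpow2 // geom.unlock.
  by rewrite !rpowE.
rewrite eL -!rpowE [r * p]mulrC.
rewrite tracenormE; last by apply: posdef_sum => // i; apply: posdef_rpow.
rewrite tracenormE; last by apply: posdef_rpow; apply: posdef_araki.
rewrite (trpowE _ (posdef_araki _ _ hsA hsB)).
have -> : \tr (\sum_(i < m) rpow (geom (rpow (A i) 2) (rpow (B i) 2)) r) =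
    (\sum_(i < m) trpow (geom (rpow (A i) 2) (rpow (B i) 2)) r)%:C.
  rewrite raddf_sum rmorph_sum /=; apply: eq_bigr => i _.
  by rewrite (trpowE _ (hX i)).
rewrite lecR.
apply: (@le_trans _ _ (\sum_(i < m) trpow (geom (A i) (B i)) (2 * r))).
  by apply: ler_sum => i _; apply: trpow_geom_square.
have r2 : 2 <= 2 * r by lra.
apply: le_trans (sum_trpow_le r2 (fun i => posdef_geom (hA i) (hB i)) (posdef_geom hsA hsB)
  (geom_sum_le hm hA hB)) _.
have := trpow_geom_le_araki hsA hsB r0 q0; rewrite /araki.
by have -> : r / (p * r) = 1 / p by field; rewrite !gt_eqF.
Qed.
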